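(* There is a non-empty open subset of the centered realization space $\mathcal{R}_{\mathbf 0}(C_4^{(24)})$ of the 24-cell that is a smooth manifold of dimension $48$.
   Context: The 24-cell $C_4^{(24)}$ is the (combinatorial type of the) regular $4$-polytope $\operatorname{conv}\{\pm\mathbf e_i\pm\mathbf e_j\mid 1\le i<j\le 4\}\subset\mathbb{R}^4$; it has $24$ vertices and $24$ facets. For a labeled $d$-polytope $P$ (vertices and facets numbered) with $n$ vertices and $m$ facets, a labeled $d$-polytope $Q\subset\mathbb{R}^d$ realizes $P$ if there is an isomorphism between the face lattices of $P$ and $Q$ respecting the labels of vertices and facets. The centered realization space is $$\mathcal{R}_{\mathbf 0}(P)=\{(V,A)\in\mathbb{R}^{d\times(n+m)} \mid \operatorname{conv}(V)=\{\mathbf x\in\mathbb{R}^d\mid A^t\mathbf x\le\mathbf 1\}\text{ realizes }P\},$$ where $\operatorname{conv}(V)$ is the convex hull of the columns of $V$, with the topology induced from $\mathbb{R}^{d\times(n+m)}$. ''Smooth manifold'' means smoothly embedded submanifold of $\mathbb{R}^{d\times(n+m)}$ (here $\mathbb{R}^{192}$). *)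

(* Defs.v *)
From HB Require Import structures.
From mathcomp Require Import all_boot all_order all_algebra.
From mathcomp Require Import all_classical all_reals all_analysis.

Set Implicit Arguments.
Unset Strict Implicit.
Unset Printing Implicit Defensive.

Import Order.TTheory GRing.Theory Num.Theory.
Import numFieldNormedType.Exports.

Local Open Scope classical_set_scope.
Local Open Scope ring_scope.

(** * Polytopes *)

Definition dot (R : realType) (d : nat) (a x : 'cV[R]_d) : R :=
  (a^T *m x) ord0 ord0.

Definition convex_hull (R : realType) (d : nat) (S : set 'cV[R]_d) :
    set 'cV[R]_d :=
  smallest (@convex_set R 'cV[R]_d) S.

Definition columns (R : realType) (d n : nat) (V : 'M[R]_(d, n)) :
    set 'cV[R]_d :=
  range (fun i : 'I_n => col i V).

Definition polyhedron (R : realType) (d m : nat) (A : 'M[R]_(d, m)) :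
    set 'cV[R]_d :=
  [set x | forall j, (A^T *m x) j ord0 <= 1].

(* The affine hull of S has dimension k: it is p + (column space of X), with
   p and all the p + col i X in S. In particular S is non-empty. *)
Definition has_dim (R : realType) (d : nat) (S : set 'cV[R]_d) (k : nat) :
    Prop :=
  exists (p : 'cV[R]_d) (X : 'M[R]_(d, k)),
    [/\ \rank X = k, S p, forall i, S (p + col i X) &
        forall x, S x -> exists c : 'cV[R]_k, x = p + X *m c].

Definition is_polytope (R : realType) (d : nat) (Q : set 'cV[R]_d) : Prop :=
  (exists2 S : set 'cV[R]_d, finite_set S & Q = convex_hull S) /\ has_dim Q d.

(* The empty face and Q itself are given by a = 0 with b = 1, b = 0. *)
Definition face (R : realType) (d : nat) (Q F : set 'cV[R]_d) : Prop :=
  exists (a : 'cV[R]_d) (b : R),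
    (forall x, Q x -> dot a x <= b) /\ F = Q `&` [set x | dot a x = b].

Definition vertex (R : realType) (d : nat) (Q : set 'cV[R]_d)
    (v : 'cV[R]_d) : Prop :=
  face Q [set v].

Definition facet (R : realType) (d : nat) (Q F : set 'cV[R]_d) : Prop :=
  face Q F /\ exists2 k : nat, k.+1 = d & has_dim F k.

Record labeled_polytope (R : realType) (d n m : nat) := LabeledPolytope {
  body : set 'cV[R]_d;
  vert : 'I_n -> 'cV[R]_d;
  fct : 'I_m -> set 'cV[R]_d;
  body_polytope : is_polytope body;
  vert_bij : set_bij [set: 'I_n] [set v | vertex body v] vert;
  fct_bij : set_bij [set: 'I_m] [set F | facet body F] fct
}.

Definition realizes (R : realType) (d n m : nat)
    (Q P : labeled_polytope R d n m) : Prop :=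
  exists f : set 'cV[R]_d -> set 'cV[R]_d,
    [/\ set_bij [set F | face (body P) F] [set F | face (body Q) F] f,
        forall F G, face (body P) F -> face (body P) G ->
          (F `<=` G <-> f F `<=` f G),
        forall i, f [set vert P i] = [set vert Q i] &
        forall j, f (fct P j) = fct Q j].

(* The pair (V, A) is the single matrix row_mx V A. Column i of V is the i-th
   vertex, and column j of A is the normal vector of the j-th facet. *)
Definition centered_realization_space (R : realType) (d n m : nat)
    (P : labeled_polytope R d n m) : set 'M[R]_(d, n + m) :=
  [set M | let V := lsubmx M in let A := rsubmx M in
    convex_hull (columns V) = polyhedron A /\
    exists Q : labeled_polytope R d n m,
      [/\ body Q = convex_hull (columns V),
          forall i, vert Q i = col i V,
          forall j, fct Q j = body Q `&` [set x | dot (col j A) x = 1] &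
          realizes Q P]].

Definition cell24 (R : realType) : set 'cV[R]_4 :=
  convex_hull [set x | exists (i j : 'I_4) (s t : bool), (i < j)%N /\
    x = (-1) ^+ s *: delta_mx i ord0 + (-1) ^+ t *: delta_mx j ord0].

Arguments cell24 : clear implicits.

(** * Embedded submanifolds of spaces of matrices *)

Definition partial (R : realType) (p q p' q' : nat) (s : seq ('I_p * 'I_q))
    (f : 'M[R]_(p, q) -> 'M[R]_(p', q')) : 'M[R]_(p, q) -> 'M[R]_(p', q') :=
  foldr (fun ij g => 'D_(delta_mx ij.1 ij.2) g) f s.

(* C^infinity, for U open: partial derivatives of all orders exist and are
   continuous at every point of U. *)
Definition smooth_on (R : realType) (p q p' q' : nat) (U : set 'M[R]_(p, q))
    (f : 'M[R]_(p, q) -> 'M[R]_(p', q')) : Prop :=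
  forall (s : seq ('I_p * 'I_q)) (x : 'M[R]_(p, q)), U x ->
    {for x, continuous (partial s f)} /\
    forall i j, derivable (partial s f) x (delta_mx i j).

Definition diffeomorphism_on (R : realType) (p q p' q' : nat)
    (U : set 'M[R]_(p, q)) (V : set 'M[R]_(p', q'))
    (f : 'M[R]_(p, q) -> 'M[R]_(p', q'))
    (g : 'M[R]_(p', q') -> 'M[R]_(p, q)) : Prop :=
  [/\ open U /\ open V, smooth_on U f, smooth_on V g,
      forall x, U x -> V (f x) /\ g (f x) = x &
      forall y, V y -> U (g y) /\ f (g y) = y].

(* Slice charts: around each of its points, M is straightened by an ambient
   diffeomorphism to the coordinate subspace R^k x {0} of R^(p * q). *)
Definition embedded_submanifold (R : realType) (p q k : nat)
    (M : set 'M[R]_(p, q)) : Prop :=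
  (k <= p * q)%N /\
  forall x, M x ->
    exists (U : set 'M[R]_(p, q)) (V : set 'rV[R]_(p * q))
           (f : 'M[R]_(p, q) -> 'rV[R]_(p * q))
           (g : 'rV[R]_(p * q) -> 'M[R]_(p, q)),
      [/\ U x, diffeomorphism_on U V f g &
          f @` (U `&` M) =
          V `&` [set y : 'rV[R]_(p * q) |
               forall l : 'I_(p * q), (k <= l)%N -> y ord0 l = 0]].

(* Main.v *)
From Stdlib Require Import ZArith.
From HB Require Import structures.
From mathcomp Require Import all_boot all_order all_algebra.
From mathcomp Require Import all_classical all_reals all_analysis.
From mathcomp Require Import ring lra zify ssrZ.
Require Import Defs.

Set Implicit Arguments.
Unset Strict Implicit.
Unset Printing Implicit Defensive.

Import Order.TTheory GRing.Theory Num.Theory.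
Import numFieldNormedType.Exports.

Local Open Scope classical_set_scope.
Local Open Scope ring_scope.

Delimit Scope Z_scope with BZ.

(** Write v_i for the columns of V and a_j for those of A.  Every point (V, A)
    of the realization space satisfies v_i . a_j = 1 whenever vertex i lies on
    facet j.  These are 144 quadratic equations in 192 unknowns, so the theorem
    follows from three facts about them.

    Close to the regular 24-cell the equations characterize realizations.
    Incidences determine the whole face lattice, because a face of a polytope
    given both by its vertices and by its facets is the intersection of the
    facets through it ([face_closed], [dual_pair_realizes]).  So only the
    equality conv(V) = {x | A^t x <= 1} is at stake.  A set J of facets of the
    regular cell without common vertex satisfies
    sum_(j in J) a_j . x <= |J| - 1 on the cell; this gap survives a
    perturbation, so that the constraints that are tight at a point of the
    perturbed polyhedron are all tight at some v_i ([near_tight_cover]).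
    Leaving v_i through the point until a further constraint becomes tight
    writes the point as a convex combination by induction
    ([half_spaces_sub_hull]).

    The 144 differentials are independent at points arbitrarily close to the
    regular cell.  At the regular cell itself their rank is only 140.  But the
    regular cell has a one-parameter deformation with a symmetry group of order
    48, generated by (x1, x2, x3, x4) |-> (x3, x1, -x4, x2) and
    (x1, x2, x3, x4) |-> (x1, -x4, x2, -x3): the vertices are the orbit of
    (1, 1, t, 0), and the facet normals are the vectors +e_i, -e_i and the orbit
    of (p, q, p, p) with p = 1 / (2 - t) and q = (1 - 2 t) / (2 - t).  At
    t = 1/1000 the Jacobian has full rank 144, already modulo 7
    ([jac_mul_mod7], [jacobian_surjective]).

    The zero set of a quadratic map near a point where its differential is onto
    is a submanifold of the expected codimension ([quadratic_level_set]).  After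
    a linear change of coordinates the straightening map is w |-> w + Q(w, w);
    it is inverted by Banach's fixed point theorem, and its inverse is smooth
    because its coordinates together with the inverse of the Jacobian
    determinant generate an algebra closed under partial derivatives.

    The chosen open set is the intersection of the two neighbourhoods, of the
    regular cell and of the deformed one, from the first and third facts
    ([labelled_manifold]).  The labels of the given polytope enter only through
    two bijections with the standard numbering of roots and coroots. *)

(** * Algebras of functions closed under partial derivatives *)

Section GeneratedAlgebra.
Context (R : realType) (p q : nat).
Implicit Types f g h : 'M[R]_(p, q) -> R.

(** Smoothness asks for partial derivatives of all orders; an inductively
    generated algebra that is closed under one partial derivative is closed
    under all of them, which reduces the question to its generators. *)
Inductive gen_alg (I : Type) (gen : I -> 'M[R]_(p, q) -> R) :
    ('M[R]_(p, q) -> R) -> Prop :=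
| gen_alg_gen i : gen_alg gen (gen i)
| gen_alg_cst c : gen_alg gen (fun=> c)
| gen_algD f g : gen_alg gen f -> gen_alg gen g -> gen_alg gen (f \+ g)
| gen_algM f g : gen_alg gen f -> gen_alg gen g -> gen_alg gen (f \* g).

Section Closure.
Context (I : Type) (gen : I -> 'M[R]_(p, q) -> R).

Lemma gen_alg_sum (J : Type) (r : seq J) (P : pred J) F :
  (forall j, gen_alg gen (F j)) ->
  gen_alg gen (fun x => \sum_(j <- r | P j) F j x).
Proof.
move=> hF; rewrite (_ : (fun _ => _) = \sum_(j <- r | P j) F j); last first.
  by apply/funext => x; rewrite fct_sumE.
by apply: big_ind => // [|f g]; [exact: gen_alg_cst | exact: gen_algD].
Qed.

Lemma gen_alg_prod (J : Type) (r : seq J) (P : pred J) F :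
  (forall j, gen_alg gen (F j)) ->
  gen_alg gen (fun x => \prod_(j <- r | P j) F j x).
Proof.
move=> hF; rewrite (_ : (fun _ => _) = \prod_(j <- r | P j) F j); last first.
  by apply/funext => x; rewrite fct_prodE.
by apply: big_ind => // [|f g]; [exact: gen_alg_cst | exact: gen_algM].
Qed.

Lemma gen_alg_det n (A : 'M[R]_(p, q) -> 'M[R]_n) :
  (forall i j, gen_alg gen (fun x => A x i j)) ->
  gen_alg gen (fun x => \det (A x)).
Proof.
move=> hA; apply: gen_alg_sum => s; apply: gen_algM; first exact: gen_alg_cst.
by apply: gen_alg_prod => i; exact: hA.
Qed.

Lemma gen_alg_adj n (A : 'M[R]_(p, q) -> 'M[R]_n) i j :
  (forall i j, gen_alg gen (fun x => A x i j)) ->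
  gen_alg gen (fun x => (\adj (A x)) i j).
Proof.
move=> hA.
rewrite (_ : (fun _ => _) =
  (fun=> (-1) ^+ (j + i)) \* (fun x => \det (row' j (col' i (A x))))).
  apply: gen_algM; first exact: gen_alg_cst.
  apply: gen_alg_det => a b.
  by rewrite (_ : (fun _ => _) = fun x => A x (lift j a) (lift i b));
    [exact: hA | apply/funext => x; rewrite !mxE].
by apply/funext => x /=; rewrite mxE /cofactor.
Qed.

End Closure.

Section Calculus.
Context (U : set 'M[R]_(p, q)) (I : Type) (gen : I -> 'M[R]_(p, q) -> R).

Lemma gen_alg_cont f x :
  (forall i, {for x, continuous (gen i)}) -> gen_alg gen f ->
  {for x, continuous f}.
Proof.
move=> hg; elim=> [i|c|g h _ cg _ ch|g h _ cg _ ch].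
- exact: hg.
- exact: cst_continuous.
- exact: continuousD.
- exact: continuousM.
Qed.

(** Two families of generators, because the derivatives of the first one may
    need more functions: the coordinates of an inverse map have derivatives that
    involve the inverse of a determinant. *)
Lemma gen_alg_deriv I' (gen' : I' -> 'M[R]_(p, q) -> R) f a b :
  (forall i, gen_alg gen' (gen i)) ->
  (forall i, exists2 h, gen_alg gen' h & forall x, U x ->
     is_derive x (delta_mx a b : 'M[R]_(p, q)) (gen i) (h x)) ->
  gen_alg gen f -> exists2 h, gen_alg gen' h &
  forall x, U x -> is_derive x (delta_mx a b : 'M[R]_(p, q)) f (h x).
Proof.
move=> gen_gen' gen_deriv af.
suff [] : gen_alg gen' f /\ exists2 h, gen_alg gen' h &
  forall x, U x -> is_derive x (delta_mx a b : 'M[R]_(p, q)) f (h x) by [].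
elim: af => {f} [i|c|g h _ [ag [g' ag' dg]] _ [ah [h' ah' dh]]|
                   g h _ [ag [g' ag' dg]] _ [ah [h' ah' dh]]].
- by split.
- split; first exact: gen_alg_cst.
  exists (fun=> 0); first exact: gen_alg_cst.
  by move=> x _; exact: is_derive_cst.
- split; first exact: gen_algD.
  exists (g' \+ h'); first exact: gen_algD.
  by move=> x Ux; have dgx := dg x Ux; have dhx := dh x Ux; exact: is_deriveD.
- split; first exact: gen_algM.
  exists ((g \* h') \+ (h \* g')); first by apply: gen_algD; exact: gen_algM.
  by move=> x Ux; have dgx := dg x Ux; have dhx := dh x Ux; exact: is_deriveM.
Qed.

Hypothesis oU : open U.
Hypothesis gen_cont : forall i x, U x -> {for x, continuous (gen i)}.
Hypothesis gen_deriv : forall i a b, exists2 h, gen_alg gen h &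
  forall x, U x -> is_derive x (delta_mx a b : 'M[R]_(p, q)) (gen i) (h x).

Lemma gen_alg_smooth p' q' (f : 'M[R]_(p, q) -> 'M[R]_(p', q')) :
  (forall i j, exists2 h, gen_alg gen h & forall x, U x -> f x i j = h x) ->
  smooth_on U f.
Proof.
move=> hf.
have nearU x : U x -> \forall y \near x, U y by move=> Ux; exact: open_nbhs_nbhs.
have deriv (g : 'M[R]_(p, q) -> 'M[R]_(p', q')) a b :
    (forall i j, exists2 h, gen_alg gen h & forall x, U x -> g x i j = h x) ->
    forall i j, exists2 h, gen_alg gen h & forall x, U x ->
      is_derive x (delta_mx a b) (fun y => g y i j) (h x).
  move=> hg i j; have [h ah gh] := hg i j.
  have [h' ah' dh] := gen_alg_deriv (@gen_alg_gen _ gen) (fun i => gen_deriv i a b) ah.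
  exists h' => // x Ux; apply: near_eq_is_derive (dh x Ux).
  by near=> y; apply/esym/gh; near: y; exact: nearU.
have derivg (g : 'M[R]_(p, q) -> 'M[R]_(p', q')) a b x :
    (forall i j, exists2 h, gen_alg gen h & forall x, U x -> g x i j = h x) ->
    U x -> derivable g x (delta_mx a b).
  move=> hg Ux; apply/derivable_mxP => i j.
  by have [h _ /(_ x Ux)[]] := deriv _ a b hg i j.
have hs s : forall i j, exists2 h, gen_alg gen h &
    forall x, U x -> partial s f x i j = h x.
  elim: s => [|[a b] s IHs] //= i j.
  have [h ah dh] := deriv _ a b IHs i j.
  exists h => // x Ux; rewrite derive_mx ?mxE; last exact: derivg.
  by have [_ ->] := dh x Ux.
move=> s x Ux; split; last by move=> i j; exact: derivg.
have FF := nbhs_filter x; apply/(@cvgrPdist_le _ _ _ _ FF) => /= e e0.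
have close : \forall y \near x, forall ij : 'I_p' * 'I_q',
    `|partial s f x ij.1 ij.2 - partial s f y ij.1 ij.2| <= e.
  apply: (@filter_forall _ _ _ _ FF) => -[i j] /=; have [h ah hE] := hs s i j.
  have /(@cvgrPdist_le _ _ _ _ FF) /(_ _ e0) hc := gen_alg_cont (fun i => @gen_cont i x Ux) ah.
  near=> y; rewrite !hE //; last by near: y; exact: nearU.
  by near: y.
near=> y; rewrite [leLHS]/Num.Def.normr/= mx_normrE (bigmax_le _ (ltW e0))//=.
by move=> ij _; rewrite !mxE /=; move: ij; near: y.
Unshelve. all: by end_near. Qed.

End Calculus.

End GeneratedAlgebra.

(** * Inverting the map w + Q(w, w) *)

Lemma mx_entry_le (R : realType) m n (M : 'M[R]_(m, n)) i j : `|M i j| <= `|M|.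
Proof.
rewrite [leRHS]/Num.Def.normr /= mx_normrE.
exact: (le_bigmax _ _ (i, j)).
Qed.

Lemma mx_norm_le (R : realType) m n (M : 'M[R]_(m, n)) e :
  0 <= e -> (forall i j, `|M i j| <= e) -> `|M| <= e.
Proof.
move=> e0 he; rewrite [leLHS]/Num.Def.normr /= mx_normrE.
by apply: bigmax_le => // -[i j] _; exact: he.
Qed.

HB.instance Definition _ (R : realType) m n := Complete.on 'M[R]_(m, n).

Section QuadraticInverse.
Context (R : realType) (N : nat) (q : 'I_N -> 'M[R]_N).
Implicit Types w h k y : 'rV[R]_N.

Definition quad w h : 'rV[R]_N := \row_l (w *m q l *m h^T) 0 0.

Let G w := w + quad w w.

Definition quad_bound : R := 1 + \sum_l \sum_a \sum_b `|q l a b|.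
Let C := quad_bound.

Let C_gt0 : 0 < C.
Proof.
rewrite ltr_pwDl // sumr_ge0 // => l _; rewrite sumr_ge0 // => a _.
by rewrite sumr_ge0.
Qed.

Lemma quadE w h l : quad w h 0 l = (w *m q l *m h^T) 0 0.
Proof. by rewrite mxE. Qed.

Lemma quadDl w w' h : quad (w + w') h = quad w h + quad w' h.
Proof.
by apply/rowP => l; rewrite [RHS]mxE !quadE !mulmxDl [LHS]mxE.
Qed.

Lemma quadDr w h h' : quad w (h + h') = quad w h + quad w h'.
Proof.
by apply/rowP => l; rewrite [RHS]mxE !quadE linearD mulmxDr [LHS]mxE.
Qed.

Lemma quadNl w h : quad (- w) h = - quad w h.
Proof. by apply/rowP => l; rewrite [RHS]mxE !quadE !mulNmx [LHS]mxE. Qed.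

Lemma quadNr w h : quad w (- h) = - quad w h.
Proof. by apply/rowP => l; rewrite [RHS]mxE !quadE linearN mulmxN [LHS]mxE. Qed.

Lemma quad_le w h : `|quad w h| <= C * `|w| * `|h|.
Proof.
apply: mx_norm_le => [|i l]; first by rewrite !mulr_ge0 // ltW.
rewrite ord1 quadE -mulrA; apply: (@le_trans _ _ ((\sum_a \sum_b `|q l a b|) * (`|w| * `|h|))).
  rewrite mxE; apply: le_trans (ler_norm_sum _ _ _) _.
  rewrite exchange_big mulr_suml; apply: ler_sum => b _ /=.
  rewrite [(_ *m _) _ _]mxE [_^T _ _]mxE normrM mulr_suml.
  rewrite [leRHS](_ : _ = (\sum_a `|w| * `|q l a b|) * `|h|); last first.
    by rewrite mulr_suml; apply: eq_bigr => a _; ring.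
  apply: ler_pM => //; last exact: mx_entry_le.
  apply: le_trans (ler_norm_sum _ _ _) _; apply: ler_sum => a _.
  by rewrite normrM ler_wpM2r // mx_entry_le.
rewrite ler_wpM2r ?mulr_ge0 // /C /quad_bound [X in 1 + X](bigD1 l) //= addrCA lerDl.
rewrite addr_ge0 // sumr_ge0 // => l' _; rewrite sumr_ge0 // => a _.
by rewrite sumr_ge0.
Qed.

(** The differential of [w |-> quad w w] at [h], as a matrix that acts on row
    vectors from the right. *)
Definition quad_lin h : 'M[R]_N :=
  \matrix_(b, l) ((h *m q l) 0 b + (q l *m h^T) b 0).

Lemma mul_quad_lin h k : k *m quad_lin h = quad h k + quad k h.
Proof.
apply/rowP => l; rewrite [RHS]mxE !quadE [LHS]mxE.
under eq_bigr do rewrite [quad_lin _ _ _]mxE mulrDr.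
rewrite big_split /=; congr (_ + _).
  rewrite [RHS]mxE; apply: eq_bigr => b _.
  by rewrite [k^T _ _]mxE mulrC.
by rewrite -mulmxA [RHS]mxE.
Qed.

Let J h := 1%:M + quad_lin h.

(** On the ball of this radius [h |-> quad h h] is Lipschitz with constant 1/2. *)
Definition quad_radius : R := (4 * C)^-1.
Let r := quad_radius.

Let r_gt0 : 0 < r. Proof. by rewrite invr_gt0 mulr_gt0. Qed.

Let Cr : C * r = 4^-1.
Proof. by rewrite /r /quad_radius; field; rewrite gt_eqF. Qed.

Lemma quad_jac_ge h k : `|h| <= r -> `|k| <= 2 * `|k *m J h|.
Proof.
move=> hr; rewrite /J mulmxDr mulmx1 mul_quad_lin.
have h1 := quad_le h k; have h2 := quad_le k h.
have Ch : C * `|h| <= 4^-1 by rewrite -Cr ler_wpM2l // ltW.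
have k0 := normr_ge0 k.
have := ler_normB (k + (quad h k + quad k h)) (quad h k + quad k h).
rewrite addrK => /le_trans/(_ (lerD (lexx _) (ler_normD _ _))).
nra.
Qed.

Lemma quad_jac_unit h : `|h| <= r -> J h \in unitmx.
Proof.
move=> hr; rewrite -row_free_unit; apply: inj_row_free => v vJ0.
have := quad_jac_ge v hr; rewrite vJ0 normr0 mulr0.
by rewrite normr_le0 => /eqP.
Qed.

Lemma quad_diff h h' :
  G h' - G h = (h' - h) *m J h + quad (h' - h) (h' - h).
Proof.
rewrite /J mulmxDr mulmx1 mul_quad_lin /G.
rewrite !(quadDl, quadDr, quadNl, quadNr).
by apply/rowP => l; rewrite ![in LHS]mxE ![in RHS]mxE; ring.
Qed.

Lemma quad_expand h h' : `|h| <= r -> `|h'| <= r ->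
  `|h' - h| <= 2 * `|G h' - G h|.
Proof.
move=> hr h'r.
have -> : G h' - G h = (h' - h) + (quad (h' - h) h' + quad h (h' - h)).
  by rewrite /G !(quadDl, quadDr, quadNl, quadNr); apply/rowP => l;
    rewrite ![in LHS]mxE ![in RHS]mxE; ring.
set k := h' - h.
have h1 := quad_le k h'; have h2 := quad_le h k.
have Ch : C * `|h| <= 4^-1 by rewrite -Cr ler_wpM2l // ltW.
have Ch' : C * `|h'| <= 4^-1 by rewrite -Cr ler_wpM2l // ltW.
have k0 := normr_ge0 k.
have := ler_normB (k + (quad k h' + quad h k)) (quad k h' + quad h k).
rewrite addrK => /le_trans/(_ (lerD (lexx _) (ler_normD _ _))).
nra.
Qed.

(** [h] solves the equation exactly when it is a fixed point of
    [h |-> y - quad h h], a contraction of the closed ball. *)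
Lemma quad_solve y : `|y| < r / 2 -> exists h, `|h| < r /\ G h = y.
Proof.
move=> yr.
have r0 := r_gt0.
pose B := [set h : 'rV[R]_N | `|h| <= r].
pose f h := y - quad h h.
have fB : {homo f : h / B h}.
  move=> h hr; rewrite /B /= in hr *.
  have := quad_le h h.
  have Ch : C * `|h| <= 4^-1 by rewrite -Cr ler_wpM2l // ltW.
  have h0 := normr_ge0 h.
  have := ler_normB y (quad h h).
  by rewrite /f; nra.
have ctr : is_contraction (mkfun_fun fB).
  exists (2^-1)%:nng; split => /=; first by rewrite invf_lt1 // ltr1n.
  move=> [h h'] [/= hr h'r]; rewrite /mkfun /f.
  rewrite /B /= in hr h'r.
  have -> : y - quad h h - (y - quad h' h') = quad (h' - h) h' + quad h (h' - h).
    by rewrite !(quadDl, quadDr, quadNl, quadNr); apply/rowP => l;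
      rewrite ![in LHS]mxE ![in RHS]mxE; ring.
  have h1 := quad_le (h' - h) h'; have h2 := quad_le h (h' - h).
  have Ch : C * `|h| <= 4^-1 by rewrite -Cr ler_wpM2l // ltW.
  have Ch' : C * `|h'| <= 4^-1 by rewrite -Cr ler_wpM2l // ltW.
  have k0 := normr_ge0 (h' - h).
  rewrite /= [`|h - h'|]distrC.
  have := ler_normD (quad (h' - h) h') (quad h (h' - h)).
  nra.
have clB : closed B.
  by apply: (preimage_closed _ (@closed_le _ r)) => x _; exact: norm_continuous.
have B0 : B !=set0 by exists 0; rewrite /B /= normr0 ltW.
have [h hB hE] := banach_fixed_point ctr clB B0.
have {}hE : h = y - quad h h by exact: hE.
have Gh : G h = y by rewrite /G {1}hE subrK.
exists h; split => //.
have := quad_le h h.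
have Ch : C * `|h| <= 4^-1 by rewrite -Cr ler_wpM2l // ltW.
have h0 := normr_ge0 h.
have := ler_normB y (quad h h); rewrite -hE; nra.
Qed.

Definition quad_inv y : 'rV[R]_N := xget 0 [set h | `|h| < r /\ G h = y].

Lemma quad_invP y : `|y| < r / 2 -> `|quad_inv y| < r /\ G (quad_inv y) = y.
Proof.
move=> /quad_solve [h hP]; rewrite /quad_inv.
exact: (@xgetPex _ 0 [set h | `|h| < r /\ G h = y] (ex_intro _ h hP)).
Qed.

Lemma quad_invK h : `|h| < r -> `|G h| < r / 2 -> quad_inv (G h) = h.
Proof.
move=> hr /quad_invP [gr gE]; apply/eqP; rewrite -subr_eq0 -normr_le0.
by rewrite (le_trans (quad_expand (ltW hr) (ltW gr)))// gE subrr normr0 mulr0.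
Qed.

Lemma quad_inv_lip y y' : `|y| < r / 2 -> `|y'| < r / 2 ->
  `|quad_inv y' - quad_inv y| <= 2 * `|y' - y|.
Proof.
move=> /quad_invP [gr gE] /quad_invP [gr' gE'].
by rewrite -{2}gE -{2}gE'; apply: quad_expand; exact: ltW.
Qed.

Lemma open_quad_codom : open [set y : 'rV[R]_N | `|y| < r / 2].
Proof.
by apply: (@open_comp _ _ (fun y : 'rV[R]_N => `|y|) [set x | x < r / 2]) => // x _;
  exact: norm_continuous.
Qed.

Lemma quad_inv_cont y : `|y| < r / 2 -> {for y, continuous quad_inv}.
Proof.
move=> yr; have FF := nbhs_filter y; apply/(@cvgrPdist_le _ _ _ _ FF) => /= e e0.
have e20 : 0 < e / 2 by rewrite divr_gt0.
have near_y : \forall z \near y, `|y - z| <= e / 2.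
  by apply/nbhs_ballP; exists (e / 2) => //= z; rewrite -ball_normE /= => /ltW.
near=> z.
have zr : `|z| < r / 2.
  by near: z; apply: open_nbhs_nbhs; split => //; exact: open_quad_codom.
apply: le_trans (quad_inv_lip zr yr) _.
by rewrite mulrC -ler_pdivlMr //; near: z.
Unshelve. all: by end_near. Qed.

(** Solving [quad_diff] for the increment [k] of the inverse shows that [k / s]
    differs from the expected derivative by the image of [quad k k / s], which is
    of order [s] because the inverse is Lipschitz. *)
Lemma quad_inv_derive y d : `|y| < r / 2 ->
  is_derive y d quad_inv (d *m invmx (J (quad_inv y))).
Proof.
move=> yr; have [gr gE] := quad_invP yr.
have Ju := quad_jac_unit (ltW gr).
set K := invmx _.
suff lim_quot : (fun s : R => s^-1 *: (quad_inv (s *: d + y) - quad_inv y)) @ 0^'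
    --> d *m K.
  by apply: DeriveDef; [apply/cvg_ex; exists (d *m K) | exact: cvg_lim].
apply/cvgrPdist_le => /= e e0.
have D0 : 0 < 8 * C * `|d| ^+ 2 + 1.
  by rewrite ltr_wpDl // !mulr_ge0 // ?exprn_ge0 // ltW.
near=> s.
have s0 : s != 0 by near: s; exact: nbhs_dnbhs_neq.
have s0' : 0 < `|s| by rewrite normr_gt0.
have se : `|s| <= e / (8 * C * `|d| ^+ 2 + 1).
  by near: s; apply: dnbhs0_le; rewrite divr_gt0.
have sr : `|s *: d + y| < r / 2.
  near: s; apply: nbhs_dnbhs.
  apply: (@open_comp _ _ (fun s : R => s *: d + y)
    [set y : 'rV[R]_N | `|y| < r / 2]) => [t _||/=].
  - by apply: cvgD; [apply: cvgZr_tmp; exact: cvg_id | exact: cvg_cst].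
  - exact: open_quad_codom.
  - by rewrite scale0r add0r.
have := quad_inv_lip yr sr; have [gsr gsE] := quad_invP sr.
have := quad_diff (quad_inv y) (quad_inv (s *: d + y)).
rewrite gE gsE addrK; set k := _ - quad_inv y => sdE kle.
have kE : k = (s *: d - quad k k) *m K.
  by rewrite sdE addrK mulmxK.
have -> : d *m K - s^-1 *: k = s^-1 *: (quad k k *m K).
  by rewrite {1}kE mulmxBl scalerBr -scalemxAl scalerA mulVf // scale1r opprB addrC subrK.
rewrite normrZ normfV ler_pdivrMl //.
have QK : `|quad k k *m K| <= 2 * `|quad k k|.
  by have := quad_jac_ge (quad k k *m K) (ltW gr); rewrite mulmxKV.
apply: le_trans QK _.
have Qk := quad_le k k.
have ksd : `|k| <= 2 * (`|s| * `|d|) by rewrite -normrZ.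
have kk : `|k| * `|k| <= (2 * (`|s| * `|d|)) * (2 * (`|s| * `|d|)).
  by apply: ler_pM.
have C0 := C_gt0.
have Ckk : C * (`|k| * `|k|) <= C * ((2 * (`|s| * `|d|)) * (2 * (`|s| * `|d|))).
  by rewrite ler_pM2l.
apply: (@le_trans _ _ (`|s| * (`|s| * (8 * C * `|d| ^+ 2 + 1)))).
  have := sqr_ge0 `|s|; nra.
by rewrite ler_pM2l // -ler_pdivlMr.
Unshelve. all: by end_near. Qed.

End QuadraticInverse.

(** * Smoothness of the inverse, and level sets of quadratic maps *)

Section QuadInvSmooth.
Context (R : realType) (N : nat) (q : 'I_N -> 'M[R]_N).

Let V := [set y : 'rV[R]_N | `|y| < quad_radius q / 2].
Let jac y : 'M[R]_N := 1%:M + quad_lin q (quad_inv q y).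

Let coord (i : 'I_N) (y : 'rV[R]_N) : R := quad_inv q y 0 i.

(** The derivatives of the coordinates of the inverse are, by Cramer's rule,
    polynomials in the coordinates and in the inverse of the Jacobian
    determinant. *)
Definition quad_inv_gen (i : 'I_N + unit) (y : 'rV[R]_N) : R :=
  match i with inl i => coord i y | inr _ => (\det (jac y))^-1 end.

Let jac_alg i j : gen_alg coord (fun y => jac y i j).
Proof.
rewrite (_ : (fun _ => _) = (fun=> (1%:M : 'M[R]_N) i j) \+
  ((fun y => \sum_a coord a y * q j a i) \+
   (fun y => \sum_a q j i a * coord a y))); last first.
  apply/funext => y /=; rewrite mxE; congr (_ + _); rewrite mxE; congr (_ + _).
    by rewrite mxE; apply: eq_bigr.
  by rewrite mxE; apply: eq_bigr => a _; rewrite [(_^T) _ _]mxE.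
apply: gen_algD; first exact: gen_alg_cst.
apply: gen_algD; apply: gen_alg_sum => a; apply: gen_algM;
  by [exact: gen_alg_cst | exact: gen_alg_gen].
Qed.

Let coord_gen f : gen_alg coord f -> gen_alg quad_inv_gen f.
Proof.
elim=> [i|c|g h _ ag _ ah|g h _ ag _ ah].
- exact: (gen_alg_gen quad_inv_gen (inl i)).
- exact: gen_alg_cst.
- exact: gen_algD.
- exact: gen_algM.
Qed.

Let jac_unit y : V y -> jac y \in unitmx.
Proof. by move=> /quad_invP[/ltW yr _]; exact: quad_jac_unit. Qed.

Let coord_deriv i a b : exists2 h, gen_alg quad_inv_gen h &
  forall y, V y -> is_derive y (delta_mx a b : 'rV[R]_N) (coord i) (h y).
Proof.
exists (fun y => \sum_c (delta_mx a b : 'rV[R]_N) 0 c *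
                        ((\det (jac y))^-1 * (\adj (jac y)) c i)).
  apply: gen_alg_sum => c; apply: gen_algM; first exact: gen_alg_cst.
  apply: gen_algM; first exact: (gen_alg_gen quad_inv_gen (inr tt)).
  by apply: coord_gen; apply: gen_alg_adj; exact: jac_alg.
move=> y Vy; have [d dE] := quad_inv_derive (delta_mx a b) Vy.
apply: DeriveDef; first exact: ((derivable_mxP _ _ _).1 d 0 i).
move: dE; rewrite derive_mx // => /rowP/(_ i); rewrite mxE [RHS]mxE => ->.
apply: eq_bigr => c _; congr (_ * _).
by rewrite /invmx -/(jac y) (jac_unit Vy) mxE.
Qed.

Let coord_cont i y : V y -> {for y, continuous (coord i)}.
Proof.
move=> Vy; have := quad_inv_cont Vy => c.
exact: (@continuous_comp _ _ _ (quad_inv q) (fun M => M 0 i) y c (@coord_continuous _ _ _ _ _ _)).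
Qed.

Lemma quad_inv_gen_cont i y : V y -> {for y, continuous (quad_inv_gen i)}.
Proof.
move=> Vy; case: i => [i|[]]; first exact: coord_cont.
apply: continuousV; first by have := jac_unit Vy; rewrite unitmxE unitfE.
by apply: gen_alg_cont (gen_alg_det jac_alg) => i; exact: coord_cont.
Qed.

Lemma quad_inv_gen_deriv i a b : exists2 h, gen_alg quad_inv_gen h &
  forall y, V y -> is_derive y (delta_mx a b : 'rV[R]_N) (quad_inv_gen i) (h y).
Proof.
case: i => [i|[]]; first exact: coord_deriv.
have [h ah dh] := gen_alg_deriv (fun i => coord_gen (gen_alg_gen coord i))
  (fun i => coord_deriv i a b) (gen_alg_det jac_alg).
have ai := gen_alg_gen quad_inv_gen (inr tt).
exists ((fun=> -1) \* ((quad_inv_gen (inr tt) \* quad_inv_gen (inr tt)) \* h)).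
  by apply: gen_algM; [exact: gen_alg_cst | apply: gen_algM => //; exact: gen_algM].
move=> y Vy; have [dy dyE] := dh y Vy.
have d0 : \det (jac y) != 0 by have := jac_unit Vy; rewrite unitmxE unitfE.
apply: DeriveDef; first exact: derivableV.
by rewrite deriveV // dyE /GRing.scale /=; field.
Qed.

Lemma quad_inv_alg i : gen_alg quad_inv_gen (fun y => quad_inv q y 0 i).
Proof. exact: (gen_alg_gen quad_inv_gen (inl i)). Qed.

End QuadInvSmooth.

Section PolynomialSmooth.
Context (R : realType) (p q : nat).

Definition mx_coord (ij : 'I_p * 'I_q) (x : 'M[R]_(p, q)) : R := x ij.1 ij.2.

Lemma mx_coord_cont (ij : 'I_p * 'I_q) (x : 'M[R]_(p, q)) :
  {for x, continuous (mx_coord ij)}.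
Proof. exact: coord_continuous. Qed.

Lemma mx_coord_deriv ij a b : exists2 h, gen_alg mx_coord h &
  forall x, setT x -> is_derive x (delta_mx a b : 'M[R]_(p, q)) (mx_coord ij) (h x).
Proof.
exists (fun=> (delta_mx a b : 'M[R]_(p, q)) (fst ij) (snd ij)); first exact: gen_alg_cst.
move=> x _; have [d dE] := is_derive_id x (delta_mx a b : 'M[R]_(p, q)).
apply: DeriveDef; first exact: ((derivable_mxP _ _ _).1 d (fst ij) (snd ij)).
by move: dE; rewrite derive_mx // => /matrixP/(_ (fst ij) (snd ij)); rewrite mxE.
Qed.

End PolynomialSmooth.

(** The rows of [T] are a basis of the kernel of [D] followed by the rows of the
    section [S]. *)
Lemma straighten_surj (R : fieldType) N k r (D : 'M[R]_(N, r)) (S : 'M[R]_(r, N)) :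
  (k + r)%N = N -> S *m D = 1%:M ->
  exists2 T : 'M[R]_N, T \in unitmx &
    T *m D = \matrix_(a, l) (a == (k + l)%N :> nat)%:R.
Proof.
move=> kN SD; subst N.
have rD : \rank D = r.
  apply/eqP; rewrite eqn_leq rank_leq_col /=.
  by have := mxrankM_maxr S D; rewrite SD mxrank1.
have [K [Kfree KD]] : exists K : 'M[R]_(k, k + r), row_free K /\ K *m D = 0.
  have := row_base_free (kermx D).
  have : row_base (kermx D) *m D = 0.
    by apply/sub_kermxP; rewrite eq_row_base.
  move: (row_base (kermx D)); rewrite mxrank_ker rD addnK => K KD Kfree.
  by exists K.
exists (col_mx K S).
  rewrite -row_free_unit; apply: inj_row_free => v.
  rewrite -[v]hsubmxK mul_row_col => vKS.
  have v2 : rsubmx v = 0.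
    have := congr1 (mulmx^~ D) vKS.
    by rewrite mulmxDl -!mulmxA KD SD mulmx0 add0r mulmx1 mul0mx.
  move: vKS; rewrite v2 mul0mx addr0 => vK.
  have -> : lsubmx v = 0 by apply/eqP; rewrite -(mulmx_free_eq0 _ Kfree) vK.
  by rewrite row_mx0.
rewrite mul_col_mx KD SD; apply/matrixP => a l; rewrite !mxE.
case: splitP => j aj; rewrite !mxE aj.
  by rewrite (_ : (_ == _) = false) //; apply/eqP; have := ltn_ord j; lia.
by rewrite eqn_add2l.
Qed.

Section QuadraticLevelSet.
Context (R : realType) (p q r k : nat).
Context (F : 'M[R]_(p, q) -> 'rV[R]_r) (x0 : 'M[R]_(p, q)).
Context (D : 'M[R]_(p * q, r)) (S : 'M[R]_(r, p * q)).
Context (B : 'I_r -> 'M[R]_(p * q)).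
Hypothesis kr : (k + r = p * q)%N.
Hypothesis FE : forall h, F (x0 + h) =
  mxvec h *m D + \row_l (mxvec h *m B l *m (mxvec h)^T) 0 0.
Hypothesis SD : S *m D = 1%:M.

(** In the coordinates [w] given by [straighten_surj], the last [r] coordinates
    of [w + quad q' w w] are exactly the components of [F].  One chart therefore
    serves all points, and it restricts to every smaller open set. *)
Lemma quadratic_level_set : exists O1 : set 'M[R]_(p, q),
  [/\ open O1, O1 x0 &
    forall O, open O -> O `<=` O1 ->
      embedded_submanifold k ([set x | F x = 0] `&` O)].
Proof.
have [T Tu TD] := straighten_surj kr SD.
pose q' (l : 'I_(p * q)) : 'M[R]_(p * q) :=
  \sum_(e < r | l == (k + e)%N :> nat) (T *m B e *m T^T).
pose G w := w + quad q' w w.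
pose rho := quad_radius q'.
have rho0 : 0 < rho.
  rewrite invr_gt0 mulr_gt0 // ltr_pwDl // sumr_ge0 // => l _.
  by rewrite sumr_ge0 // => a _; rewrite sumr_ge0.
pose wof (x : 'M[R]_(p, q)) : 'rV[R]_(p * q) := mxvec (x - x0) *m invmx T.
pose f x := G (wof x).
pose g y := x0 + vec_mx (quad_inv q' y *m T).
have wofK w : wof (x0 + vec_mx (w *m T)) = w.
  by rewrite /wof addrC addKr vec_mxK mulmxK.
have wofI x : x0 + vec_mx (wof x *m T) = x.
  by rewrite /wof mulmxKV // mxvecK addrC subrK.
have lt_idx (e : 'I_r) : (k + e < p * q)%N by rewrite -kr ltn_add2l.
have key w e :
    G w 0 (Ordinal (lt_idx e)) = F (x0 + vec_mx (w *m T)) 0 e.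
  rewrite FE vec_mxK mxE [RHS]mxE quadE; congr (_ + _).
    rewrite -mulmxA TD mxE (bigD1 (Ordinal (lt_idx e))) //= mxE eqxx mulr1.
    rewrite big1 ?addr0 // => a /negPf ae; rewrite mxE.
    by rewrite [_ == _ :> nat](_ : _ = false) ?mulr0 // -ae.
  rewrite [RHS]mxE trmx_mul !mulmxA /q' (bigD1 e) //= big1 ?addr0 ?mulmxA //.
  by move=> i /andP[/= /eqP/addnI/val_inj ->]; rewrite eqxx.
have GF x e : f x 0 (Ordinal (lt_idx e)) = F x 0 e by rewrite /f key wofI.
have wA l : gen_alg (@mx_coord R p q) (fun x => wof x 0 l).
  rewrite (_ : (fun _ => _) = (fun x : 'M[R]_(p, q) => \sum_ab
    (x (fst ab) (snd ab) + - x0 (fst ab) (snd ab)) *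
      invmx T (mxvec_index (fst ab) (snd ab)) l)); last first.
    apply/funext => x; rewrite mxE (reindex _ (curry_mxvec_bij p q)) /=.
    by apply: eq_bigr => -[a b] _ /=; rewrite mxvecE !mxE.
  apply: gen_alg_sum => ab; apply: gen_algM; last exact: gen_alg_cst.
  apply: gen_algD; last exact: gen_alg_cst.
  exact: (gen_alg_gen (@mx_coord R p q) ab).
have poly_smooth b (h : 'M[R]_(p, q) -> 'rV[R]_b) :
    (forall j, gen_alg (@mx_coord R p q) (fun x => h x 0 j)) -> smooth_on setT h.
  move=> hA; apply: (@gen_alg_smooth R p q setT _ (@mx_coord R p q)) => [|i x _||i j].
  - exact: openT.
  - exact: mx_coord_cont.
  - exact: mx_coord_deriv.
  - by exists (fun x => h x i j) => //; rewrite ord1.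
have smooth_f : smooth_on setT f.
  apply: poly_smooth => j.
  rewrite (_ : (fun _ => _) = (fun x => wof x 0 j) \+
    (fun x => \sum_b (\sum_a wof x 0 a * q' j a b) * wof x 0 b)); last first.
    apply/funext => x /=; rewrite mxE quadE; congr (_ + _).
    by rewrite mxE; apply: eq_bigr => b _; rewrite [_^T _ _]mxE mxE.
  apply: gen_algD => //; apply: gen_alg_sum => b; apply: gen_algM => //.
  by apply: gen_alg_sum => a; apply: gen_algM => //; exact: gen_alg_cst.
pose V0 := [set y : 'rV[R]_(p * q) | `|y| < rho / 2].
have oV0 : open V0 by exact: open_quad_codom.
have smooth_g : smooth_on V0 g.
  apply: (@gen_alg_smooth R 1 (p * q) V0 _ (quad_inv_gen q')) => [//|i y Vy||i j].
  - exact: quad_inv_gen_cont.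
  - exact: quad_inv_gen_deriv.
  exists (fun y => x0 i j + \sum_l quad_inv q' y 0 l * T l (mxvec_index i j)).
    apply: gen_algD; first exact: gen_alg_cst.
    apply: gen_alg_sum => l; apply: gen_algM; last exact: gen_alg_cst.
    exact: quad_inv_alg.
  by move=> y _; rewrite /g mxE; congr (_ + _); rewrite mxE mxE.
have smooth_sub a b a' b' (U U' : set 'M[R]_(a, b)) (h : _ -> 'M[R]_(a', b')) :
    smooth_on U h -> U' `<=` U -> smooth_on U' h.
  by move=> sh UU s x /UU; exact: sh.
have cont_f : continuous f by move=> x; exact: (smooth_f [::] x I).1.
have cont_wof : continuous wof by move=> x; exact: (poly_smooth _ _ wA [::] x I).1.
exists ([set x | `|wof x| < rho] `&` (f @^-1` V0)); split.
- apply: openI; last by apply: open_comp => // x _; exact: cont_f.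
  apply: (@open_comp _ _ (fun x => `|wof x|) [set t | t < rho]) => // x _.
  apply: continuous_comp; [exact: cont_wof | exact: norm_continuous].
- have w0 : wof x0 = 0 by rewrite /wof subrr linear0 mul0mx.
  split => /=; rewrite /V0 /f /= w0 ?normr0 //.
  have -> : G 0 = 0.
    by rewrite /G add0r; apply/rowP => l; rewrite quadE !mul0mx !mxE.
  by rewrite normr0 divr_gt0.
move=> O oO OO1.
have fgK y : V0 y -> f (g y) = y.
  by move=> /quad_invP[_]; rewrite /f /g wofK.
have gfK x : O x -> g (f x) = x.
  move=> /OO1[/= wr fr]; rewrite -[RHS]wofI /g /f quad_invK //.
split; first by rewrite -kr leq_addr.
move=> x [/= Fx Ox].
exists O, (V0 `&` (g @^-1` O)), f, g; split => //.
  split.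
  - split=> //; rewrite openE => y [Vy Oy]; apply: filterI.
      by apply: open_nbhs_nbhs.
    by apply: (smooth_g [::] y Vy).1; exact: open_nbhs_nbhs.
  - exact: smooth_sub smooth_f _.
  - by apply: smooth_sub smooth_g _ => y [].
  - by move=> z Oz; split; [split => /=; [exact: (OO1 _ Oz).2|rewrite gfK] | exact: gfK].
  - by move=> y [Vy Oy]; split => //; exact: fgK.
apply/seteqP; split => [_ [z [Oz [Fz _]] <-]|y [[Vy Oy] yk]].
  split; first by split => /=; [exact: (OO1 _ Oz).2|rewrite gfK].
  move=> /= l kl; have lr : (l - k < r)%N by have := ltn_ord l; lia.
  rewrite (_ : l = Ordinal (lt_idx (Ordinal lr))) ?GF ?Fz ?mxE //.
  by apply/val_inj; rewrite /= subnKC.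
exists (g y); last exact: fgK.
split => //; split => //; apply/rowP => e.
by rewrite -GF fgK // mxE; apply: yk; rewrite /= leq_addr.
Qed.

End QuadraticLevelSet.

(** * Polytopes given by vertices and by facets *)

Section Dot.
Context (R : realType) (d : nat).
Implicit Types a x y : 'cV[R]_d.

Lemma dotE a x : dot a x = \sum_i a i 0 * x i 0.
Proof. by rewrite /dot mxE; apply: eq_bigr => i _; rewrite mxE. Qed.

Lemma dotC a x : dot a x = dot x a.
Proof. by rewrite !dotE; apply: eq_bigr => i _; rewrite mulrC. Qed.

Lemma dotDr a x y : dot a (x + y) = dot a x + dot a y.
Proof. by rewrite /dot mulmxDr mxE. Qed.

Lemma dotZr a t x : dot a (t *: x) = t * dot a x.
Proof. by rewrite /dot -scalemxAr mxE. Qed.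

Lemma dotDl a b x : dot (a + b) x = dot a x + dot b x.
Proof. by rewrite dotC dotDr !(dotC x). Qed.

Lemma dotZl t a x : dot (t *: a) x = t * dot a x.
Proof. by rewrite dotC dotZr dotC. Qed.

Lemma dotNr a x : dot a (- x) = - dot a x.
Proof. by rewrite -scaleN1r dotZr mulN1r. Qed.

Lemma dotBr a x y : dot a (x - y) = dot a x - dot a y.
Proof. by rewrite dotDr dotNr. Qed.

Lemma dot0r a : dot a 0 = 0.
Proof. by rewrite /dot mulmx0 mxE. Qed.

Lemma dot_sumr (I : Type) (s : seq I) (P : pred I) (F : I -> 'cV[R]_d) a :
  dot a (\sum_(i <- s | P i) F i) = \sum_(i <- s | P i) dot a (F i).
Proof. by elim/big_rec2: _ => [|i y x _ <-]; rewrite ?dot0r ?dotDr. Qed.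

Lemma dot_suml (I : Type) (s : seq I) (P : pred I) (F : I -> 'cV[R]_d) x :
  dot (\sum_(i <- s | P i) F i) x = \sum_(i <- s | P i) dot (F i) x.
Proof. by rewrite dotC dot_sumr; apply: eq_bigr => i _; rewrite dotC. Qed.

Lemma dot_delta (k : 'I_d) x : dot (delta_mx k 0) x = x k 0.
Proof.
rewrite dotE (bigD1 k) //= mxE !eqxx mul1r big1 ?addr0 // => l /negPf lk.
by rewrite mxE lk mul0r.
Qed.

Lemma dot_norm_le a x : `|dot a x| <= d%:R * `|a| * `|x|.
Proof.
rewrite dotE; apply: le_trans (ler_norm_sum _ _ _) _.
apply: (@le_trans _ _ (\sum_(k < d) `|a| * `|x|)).
  by apply: ler_sum => k _; rewrite normrM ler_pM // mx_entry_le.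
by rewrite sumr_const card_ord -[leLHS]mulr_natl mulrA.
Qed.

End Dot.

Section Hull.
Context (R : realType) (d : nat).
Implicit Types (A : set 'cV[R]_d) (x y : 'cV[R]_d).

Lemma convex_set_cV A :
  (forall x y t, A x -> A y -> 0 <= t -> t <= 1 -> A (t *: x + (1 - t) *: y)) <->
  @convex_set R 'cV[R]_d A.
Proof.
split=> [hA x y t | hA x y t Ax Ay t0 t1].
  rewrite !inE => Ax Ay; exact: hA.
by have := hA x y (Itv01 t0 t1); rewrite !inE; exact.
Qed.

Lemma convex_hull_convex A x y t : convex_hull A x -> convex_hull A y ->
  0 <= t -> t <= 1 -> convex_hull A (t *: x + (1 - t) *: y).
Proof.
move=> Ax Ay t0 t1 B [cB AB].
have AxB : B x by exact: Ax.
have AyB : B y by exact: Ay.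
exact: ((convex_set_cV B).2 cB).
Qed.

Lemma convex_hull_comb n (v : 'I_n -> 'cV[R]_d) x : convex_hull (range v) x ->
  exists2 w : 'I_n -> R, (forall i, 0 <= w i) &
    \sum_i w i = 1 /\ x = \sum_i w i *: v i.
Proof.
move=> vx; apply: (vx [set x | exists2 w : 'I_n -> R, (forall i, 0 <= w i) &
    \sum_i w i = 1 /\ x = \sum_i w i *: v i]); split => [|_ [i _ <-]]; last first.
  exists (fun j => (j == i)%:R) => [j|]; first by rewrite ler0n.
  split; rewrite (bigD1 i) //= eqxx.
    by rewrite big1 ?addr0 // => j /negPf ->.
  by rewrite scale1r big1 ?addr0 // => j /negPf ->; rewrite scale0r.
apply/convex_set_cV => y z t [w w0 [w1 ->]] [w' w'0 [w'1 ->]] t0 t1.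
exists (fun i => t * w i + (1 - t) * w' i) => [i|].
  by rewrite addr_ge0 // mulr_ge0 // subr_ge0.
split; first by rewrite big_split -!mulr_sumr w1 w'1 /= !mulr1 addrC subrK.
rewrite !scaler_sumr -big_split; apply: eq_bigr => i _ /=.
by rewrite !scalerA scalerDl.
Qed.

Lemma convex_hull_half A a b : A `<=` [set x | dot a x <= b] ->
  convex_hull A `<=` [set x | dot a x <= b].
Proof.
move=> Aab; apply: smallest_sub => //; apply/convex_set_cV => x y t /= xb yb t0 t1.
rewrite dotDr !dotZr; nra.
Qed.

End Hull.

Definition half_spaces (R : realType) d m (a : 'I_m -> 'cV[R]_d) :
  set 'cV[R]_d := [set x | forall j, dot (a j) x <= 1].

(** Induction on the number of constraints that are not tight at [x].  The ray
    from a vertex [v i] that shares all tight constraints of [x] leaves the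
    polyhedron, which has no recession direction, at a point with more tight
    constraints; [x] lies between that point and [v i]. *)
Lemma half_spaces_sub_hull (R : realType) d n m
    (v : 'I_n -> 'cV[R]_d) (a : 'I_m -> 'cV[R]_d) :
  (forall u, (forall j, dot (a j) u <= 0) -> u = 0) ->
  (forall i, half_spaces a (v i)) ->
  (forall x, half_spaces a x ->
     exists i, forall j, dot (a j) x = 1 -> dot (a j) (v i) = 1) ->
  half_spaces a `<=` convex_hull (range v).
Proof.
move=> norec va tight x ax.
have [k] := ubnP #|[pred j | dot (a j) x != 1]|.
elim: k => // k IHk in x ax *; rewrite ltnS => xk.
have vi i : convex_hull (range v) (v i) by apply: sub_gen_smallest; exists i.
have [i vix] := tight x ax.
have [->//|x_vi] := eqVneq x (v i).
pose u := x - v i.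
have [j0 j0u] : exists j, 0 < dot (a j) u.
  apply: contrapT => /forallNP Hu; move: x_vi; rewrite -subr_eq0 => /eqP; apply.
  by apply: norec => j; rewrite leNgt; apply/negP/Hu.
pose s j := (1 - dot (a j) x) / dot (a j) u.
pose j1 := [arg min_(j < j0 | 0 < dot (a j) u) s j]%O.
have [j1u j1min] : 0 < dot (a j1) u /\ forall j, 0 < dot (a j) u -> s j1 <= s j.
  by rewrite /j1; case: arg_minP.
have ut j : dot (a j) x = 1 -> dot (a j) u = 0.
  by move=> jx; rewrite dotBr jx (vix _ jx) subrr.
have s0 : 0 <= s j1 by rewrite divr_ge0 ?subr_ge0 // ltW.
pose y := x + s j1 *: u.
have ay : half_spaces a y.
  move=> j; rewrite dotDr dotZr.
  have [ju|ju] := ltP 0 (dot (a j) u).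
    by rewrite addrC -lerBrDr -ler_pdivlMr // j1min.
  by have := ax j; nra.
have yhull : convex_hull (range v) y.
  apply: IHk => //; apply: leq_trans xk; apply: proper_card.
  apply/properP; split.
    apply/fintype.subsetP => j; rewrite !inE; apply: contra => /eqP jx.
    by rewrite dotDr dotZr ut // mulr0 addr0 jx.
  exists j1; rewrite !inE.
    by apply: contraTneq j1u => /ut ->; rewrite ltxx.
  rewrite negbK dotDr dotZr /s divfK; last by rewrite gt_eqF.
  by rewrite addrC subrK.
have s1 : 0 < 1 + s j1 by rewrite ltr_wpDr.
have -> : x = (1 + s j1)^-1 *: y + (1 - (1 + s j1)^-1) *: v i.
  apply/colP => l; rewrite /y /u !mxE; field; exact: lt0r_neq0.
apply: convex_hull_convex => //; first by rewrite invr_ge0 ltW.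
by rewrite invf_le1 // lerDl.
Qed.

Section Dimension.
Context (R : realType) (d : nat).
Implicit Types S : set 'cV[R]_d.

Lemma has_dim_factor S1 S2 k1 k2 (p1 p2 : 'cV[R]_d)
    (X1 : 'M[R]_(d, k1)) (X2 : 'M[R]_(d, k2)) :
  S1 `<=` S2 -> S1 p1 -> (forall i, S1 (p1 + col i X1)) ->
  (forall x, S2 x -> exists c : 'cV[R]_k2, x = p2 + X2 *m c) ->
  exists C : 'M[R]_(k2, k1), X1 = X2 *m C.
Proof.
move=> S12 Sp1 SX1 S2X.
have [c0 c0E] := S2X _ (S12 _ Sp1).
have /choice[c cE] i := S2X _ (S12 _ (SX1 i)).
exists (\matrix_(a, i) (c i - c0) a 0); apply/matrixP => x i.
have -> : X1 x i = (p1 + col i X1 - p1) x 0 by rewrite addrC addKr mxE.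
rewrite cE c0E opprD addrACA subrr add0r -mulmxBr !mxE.
by apply: eq_bigr => a _; rewrite [in RHS]mxE.
Qed.

Lemma has_dim_le S1 S2 k1 k2 :
  S1 `<=` S2 -> has_dim S1 k1 -> has_dim S2 k2 -> (k1 <= k2)%N.
Proof.
move=> S12 [p1 [X1 [rX1 Sp1 SX1 _]]] [p2 [X2 [rX2 _ _ S2X]]].
have [C XC] := has_dim_factor S12 Sp1 SX1 S2X.
by rewrite -rX1 XC (leq_trans (mxrankM_maxl _ _)) // rank_leq_col.
Qed.

(** Nested sets of the same dimension have the same affine hull. *)
Lemma has_dim_hyperplane S1 S2 k a b :
  S1 `<=` S2 -> has_dim S1 k -> has_dim S2 k ->
  (forall x, S1 x -> dot a x = b) -> forall x, S2 x -> dot a x = b.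
Proof.
move=> S12 [p1 [X1 [rX1 Sp1 SX1 _]]] [p2 [X2 [rX2 _ _ S2X]]] S1a x S2x.
have [C XC] := has_dim_factor S12 Sp1 SX1 S2X.
have Cu : C \in unitmx.
  rewrite -row_free_unit -row_leq_rank -{1}rX1 XC.
  exact: mxrankM_maxr.
have aX1 : a^T *m X1 = 0.
  apply/rowP => i.
  have : dot a (p1 + col i X1) = b by exact: S1a.
  rewrite dotDr S1a // -[RHS]addr0 => /addrI ai.
  by rewrite [RHS]mxE -ai dotE mxE; apply: eq_bigr => j _; rewrite !mxE.
have [c cE] := S2X _ S2x; have [c0 c0E] := S2X _ (S12 _ Sp1).
have -> : x = p1 + X1 *m (invmx C *m (c - c0)).
  by rewrite XC -!mulmxA mulKVmx // cE c0E mulmxBr -addrA subrKC.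
by rewrite dotDr S1a // {1}/dot mulmxA aX1 mul0mx mxE addr0.
Qed.

End Dimension.

Section DualPair.
Context (R : realType) (d n m : nat).
Context (inc : 'I_n -> 'I_m -> bool).

Definition dual_pair (v : 'I_n -> 'cV[R]_d) (a : 'I_m -> 'cV[R]_d) : Prop :=
  (forall i j, (dot (a j) (v i) == 1) = inc i j) /\
  convex_hull (range v) = half_spaces a.

Definition closed_face (a : 'I_m -> 'cV[R]_d) (S : 'I_n -> Prop) :
    set 'cV[R]_d :=
  half_spaces a `&`
  [set x | forall j, (forall i, S i -> inc i j) -> dot (a j) x = 1].

Context (v : 'I_n -> 'cV[R]_d) (a : 'I_m -> 'cV[R]_d) (va : dual_pair v a).
Let Q := half_spaces a.

Lemma dual_pair_vert i : Q (v i).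
Proof. by rewrite /Q -va.2; apply: sub_gen_smallest; exists i. Qed.

Lemma dual_pair_comb x : Q x -> exists2 w : 'I_n -> R, (forall i, 0 <= w i) &
    \sum_i w i = 1 /\ x = \sum_i w i *: v i.
Proof. by rewrite /Q -va.2; exact: convex_hull_comb. Qed.

Lemma face_comb F x : face Q F -> F x ->
  exists2 w : 'I_n -> R, (forall i, 0 <= w i /\ (w i != 0 -> F (v i))) &
    \sum_i w i = 1 /\ x = \sum_i w i *: v i.
Proof.
move=> [c [b [cb ->]]] [/= Qx cx].
have [w w0 [w1 xE]] := dual_pair_comb Qx.
exists w => // i; split=> // wi; split; first exact: dual_pair_vert.
have slack0 : \sum_i w i * (b - dot c (v i)) = 0.
  under eq_bigr do rewrite mulrBr.
  rewrite sumrB -mulr_suml w1 mul1r -{1}cx xE dot_sumr.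
  by under [X in X - _]eq_bigr do rewrite dotZr; rewrite subrr.
have slack_ge0 j : true -> 0 <= w j * (b - dot c (v j)).
  by rewrite mulr_ge0 // subr_ge0 cb //; exact: dual_pair_vert.
have /eqP := psumr_eq0P slack_ge0 slack0 (i := i) isT.
by rewrite mulf_eq0 (negPf wi) subr_eq0 => /eqP /=.
Qed.

Lemma face_sub F G : face Q F -> face Q G ->
  (forall i, F (v i) -> G (v i)) -> F `<=` G.
Proof.
move=> fF [c [b [cb ->]]] FG x Fx.
have Qx : Q x by case: fF Fx => [? [? [_ ->]]] [].
split=> //=.
have [w w0 [w1 ->]] := face_comb fF Fx.
rewrite dot_sumr -[RHS]mul1r -w1 mulr_suml; apply: eq_bigr => i _.
rewrite dotZr; have [->|wi] := eqVneq (w i) 0; first by rewrite !mul0r.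
by have [_] := FG _ ((w0 i).2 wi); move=> /= ->.
Qed.

Lemma face_eq F G : face Q F -> face Q G ->
  (forall i, F (v i) <-> G (v i)) -> F = G.
Proof.
by move=> fF fG FG; apply/seteqP; split; apply: face_sub => // i /FG.
Qed.

Lemma face_vert F x : face Q F -> F x -> exists i, F (v i).
Proof.
move=> fF Fx; have [w w0 [w1 _]] := face_comb fF Fx.
apply: contrapT => /forallNP noF; move: w1; rewrite big1 => [/eqP|i _].
  by rewrite eq_sym oner_eq0.
by apply: contrapT => /eqP /(w0 i).2 /noF.
Qed.

Lemma closed_face_face S : face Q (closed_face a S).
Proof.
pose J j := `[< forall i, S i -> inc i j >].
exists (\sum_(j | J j) a j), (\sum_(j | J j) 1).
split=> [x Qx|]; first by rewrite dot_suml ler_sum // => j _; exact: Qx.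
apply/seteqP; split=> x [Qx] /= xS; split=> //=.
  by rewrite dot_suml; apply: eq_bigr => j /asboolP; exact: xS.
move=> j jS; have Jj : J j by exact/asboolP.
have slack0 : \sum_(j | J j) (1 - dot (a j) x) = 0.
  by rewrite sumrB -xS dot_suml subrr.
have slack_ge0 k : J k -> 0 <= 1 - dot (a k) x by rewrite subr_ge0 => _; exact: Qx.
by apply/esym/eqP; rewrite -subr_eq0 (psumr_eq0P slack_ge0 slack0).
Qed.

Lemma closed_face_vert S i : closed_face a S (v i) <->
  forall j, (forall i', S i' -> inc i' j) -> inc i j.
Proof.
split=> [[_ Si] j jS|Si]; first by rewrite -va.1; apply/eqP/Si.
split=> [|j jS]; first exact: dual_pair_vert.
by apply/eqP; rewrite va.1 Si.
Qed.

(** If [y] is tight on all facets through [F] and [z] is the barycentre of the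
    vertices of [F], then [z + e (z - y)] stays in the polytope for small [e], so
    that the functional that defines [F] cannot be smaller at [y] than at [z].
    Since no vertex lies on all facets, the empty face is not an exception. *)
Lemma face_closed F : (forall i, exists j, ~~ inc i j) -> face Q F ->
  F = closed_face a (fun i => F (v i)).
Proof.
move=> apex fF; apply/seteqP; split=> [x Fx|y [Qy yt]].
  split; first by case: fF Fx => [? [? [_ ->]]] [].
  move=> j jF; have [w w0 [w1 ->]] := face_comb fF Fx.
  rewrite dot_sumr -w1; apply: eq_bigr => i _; rewrite dotZr.
  have [->|wi] := eqVneq (w i) 0; first by rewrite mul0r.
  by have /jF := (w0 i).2 wi; rewrite -va.1 => /eqP ->; rewrite mulr1.
have [[x Fx]|/forallNP F0] := pselect (exists x, F x); last first.
  have [i iE] := face_vert (closed_face_face (fun i => F (v i))) (conj Qy yt).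
  have [j /negP] := apex i; case; move/closed_face_vert: iE; apply=> i' /F0[].
pose S i := `[< F (v i) >]; pose s : R := \sum_(i | S i) 1.
have [i0 Fi0] := face_vert fF Fx.
have s0 : 0 < s.
  rewrite /s (bigD1 i0) /=; last exact/asboolP.
  by rewrite ltr_wpDr // sumr_ge0.
pose z := s^-1 *: \sum_(i | S i) v i.
have dotz c : dot c z = s^-1 * \sum_(i | S i) dot c (v i) by rewrite dotZr dot_sumr.
clearbody z.
have z1 j : dot (a j) z <= 1.
  rewrite dotz ler_pdivrMl // mulr1; apply: ler_sum => i _.
  exact: dual_pair_vert.
case: (fF) => c [b [cb FE]].
have cz : dot c z = b.
  rewrite dotz (eq_bigr (fun=> 1 * b)) => [|i /asboolP]; last first.
    by rewrite FE mul1r => -[].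
  by rewrite -mulr_suml mulKf // gt_eqF.
have zt j : ~ (forall i, F (v i) -> inc i j) -> dot (a j) z < 1.
  move=> /existsNP[i /not_implyP[Fi /negP ij]].
  have Si : S i by exact/asboolP.
  rewrite dotz ltr_pdivrMl // mulr1 /s (bigD1 i) //= [ltRHS](bigD1 i) //=.
  rewrite ltr_leD //; last by apply: ler_sum => k _; exact: dual_pair_vert.
  by rewrite lt_neqAle va.1 ij dual_pair_vert.
pose slack j := (1 - dot (a j) z) / (1 + `|dot (a j) (z - y)|).
have den j : 0 < 1 + `|dot (a j) (z - y)| by rewrite ltr_wpDr.
pose e := \big[Order.min/1]_(j | ~~ `[< forall i, F (v i) -> inc i j >]) slack j.
have e0 : 0 < e.
  apply: lt_bigmin => // j /asboolPn /zt zj.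
  by rewrite divr_gt0 // subr_gt0.
have Qe : Q (z + e *: (z - y)).
  move=> j; rewrite dotDr dotZr.
  have [jF|jF] := pselect (forall i, F (v i) -> inc i j).
    rewrite dotBr (yt _ jF).
    suff -> : dot (a j) z = 1 by rewrite subrr mulr0 addr0.
    rewrite dotz (eq_bigr (fun=> 1)) ?mulVf ?gt_eqF // => i /asboolP /jF.
    by rewrite -va.1 => /eqP.
  have ej : e <= slack j by apply: bigmin_le_cond; exact/asboolPn.
  have : e * `|dot (a j) (z - y)| <= 1 - dot (a j) z.
    apply: le_trans (ler_wpM2r _ ej) _ => //.
    rewrite /slack mulrAC -mulrA ger_pMr ?ler_pdivrMr ?mul1r ?lerDr //.
    by rewrite subr_gt0 zt.
  have := ler_norm (dot (a j) (z - y)); nra.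
have := cb _ Qe; have := cb _ Qy; rewrite FE dotDr dotZr dotBr cz => yb zb.
split=> //=; apply/eqP; rewrite eq_le yb /=; nra.
Qed.

End DualPair.

(** * The face lattice from the incidences *)

(** A purely combinatorial description of what an incidence relation has to
    satisfy for a pair of dual descriptions to be a polytope of dimension [k + 1]
    with all its points as vertices and all its inequalities as facets.  The flags
    give the dimensions: each [f c] contains the points up to [p c] but not
    [p (c + 1)], hence these points are affinely independent. *)
Record polytopal n m (k : nat) (inc : 'I_n -> 'I_m -> bool) : Prop := Polytopal {
  vertex_antichain : forall i i', (forall j, inc i j -> inc i' j) -> i = i';
  facet_antichain : forall j j', (forall i, inc i j -> inc i j') -> j = j';
  vertex_avoids : forall i, exists j, ~~ inc i j;
  facet_avoids : forall j, exists i, ~~ inc i j;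
  facet_flag : forall j, exists (p : nat -> 'I_n) (f : nat -> 'I_m),
    [/\ forall c, (c <= k)%N -> inc (p c) j,
        forall c b, (c < k)%N -> (b <= c)%N -> inc (p b) (f c) &
        forall c, (c < k)%N -> ~~ inc (p c.+1) (f c)] }.

Section VerticesFacets.
Context (R : realType) (k n m : nat) (inc : 'I_n -> 'I_m -> bool).
Hypothesis comb : polytopal k inc.
Context (v : 'I_n -> 'cV[R]_k.+1) (a : 'I_m -> 'cV[R]_k.+1).
Hypothesis va : dual_pair inc v a.
Let Q := half_spaces a.

Definition facet_at (j : 'I_m) : set 'cV[R]_k.+1 :=
  half_spaces a `&` [set x | dot (a j) x = 1].

Lemma closed_face_set1 i : closed_face inc a (eq i) = [set v i].
Proof.
have fF := closed_face_face inc a (eq i).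
apply/seteqP; split=> [x xF|_ ->]; last first.
  by apply/(closed_face_vert va) => j; apply.
have [w w0 [w1 ->]] := face_comb va fF xF.
have wi i' : i' != i -> w i' = 0.
  move=> ii'; apply: contrapT => /eqP /(w0 i').2 /(closed_face_vert va) Fi'.
  case/eqP: ii'; apply/esym/(vertex_antichain comb) => j ij.
  by apply: Fi' => _ <-.
rewrite /= (bigD1 i) //= big1 ?addr0 => [|i' /wi ->]; last by rewrite scale0r.
suff -> : w i = 1 by rewrite scale1r.
by rewrite -w1 (bigD1 i) //= big1 ?addr0 // => i' /wi ->.
Qed.

Lemma vertex_face i : vertex Q (v i).
Proof. by rewrite /vertex -closed_face_set1; exact: closed_face_face. Qed.

Lemma vert_inj : injective v.
Proof.
move=> i i' vii'; apply: (vertex_antichain comb) => j.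
by rewrite -!va.1 vii'.
Qed.

Lemma vertexE w : vertex Q w -> exists i, w = v i.
Proof. by move=> wF; have [i <-] := face_vert va wF (erefl w); exists i. Qed.

Lemma closed_face_facet j : closed_face inc a (fun i => inc i j) = facet_at j.
Proof.
apply/seteqP; split=> x [Qx] /= xj; split=> //=; first exact: xj.
by move=> j' /(facet_antichain comb) <-.
Qed.

Lemma facet_at_face j : face Q (facet_at j).
Proof. by rewrite -closed_face_facet; exact: closed_face_face. Qed.

Lemma facet_at_vert i j : facet_at j (v i) <-> inc i j.
Proof.
rewrite -va.1; split=> [[_ /= ->] //|/eqP ij]; split=> //.
exact: (dual_pair_vert va).
Qed.

Lemma facet_at_inj : injective facet_at.
Proof.
move=> j j' jj'; apply: (facet_antichain comb) => i.
by move=> /(facet_at_vert i j).2; rewrite jj' => /(facet_at_vert i j').1.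
Qed.

(** Evaluated at the normals [f c], the differences of the points [p] form a
    triangular matrix with non-zero diagonal. *)
Lemma flag_rank e (p : nat -> 'I_n) (f : nat -> 'I_m) :
  (forall c b, (c < e)%N -> (b <= c)%N -> inc (p b) (f c)) ->
  (forall c, (c < e)%N -> ~~ inc (p c.+1) (f c)) ->
  \rank (\matrix_(x < k.+1, c < e) (v (p c.+1) - v (p 0%N)) x 0) = e.
Proof.
move=> pf npf; set X := \matrix_(x, c) _.
pose A := \matrix_(c < e, x < k.+1) a (f c) x 0.
have AX c b : (A *m X) c b = dot (a (f c)) (v (p b.+1)) - 1.
  have /eqP <- : dot (a (f c)) (v (p 0%N)) == 1 by rewrite va.1 pf.
  by rewrite -dotBr dotE mxE; apply: eq_bigr => x _; rewrite !mxE.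
have AXu : (A *m X)^T \in unitmx.
  rewrite unitmxE unitfE det_trig.
    apply/prodf_neq0 => c _; rewrite mxE AX subr_eq0 va.1.
    exact: npf.
  apply/is_trig_mxP => b c bc; rewrite mxE AX.
  by apply/eqP; rewrite subr_eq0 va.1 pf.
rewrite unitmx_tr in AXu.
apply/eqP; rewrite eqn_leq rank_leq_col -{1}(mxrank_unit AXu).
exact: mxrankM_maxr.
Qed.

Lemma half_spaces_dim (j0 : 'I_m) : has_dim Q k.+1.
Proof.
have [p [f [pj pf npf]]] := facet_flag comb j0.
have [i ij] := facet_avoids comb j0.
pose p' c := if (c <= k)%N then p c else i.
pose f' c := if (c < k)%N then f c else j0.
have rX : \rank (\matrix_(x < k.+1, c < k.+1) (v (p' c.+1) - v (p' 0%N)) x 0) = k.+1.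
  apply: (@flag_rank k.+1 p' f') => [c b|c].
    rewrite ltnS /p' /f' => ck bc; rewrite (leq_trans bc ck).
    case: ltnP => [ck'|_]; first exact: pf.
    by apply: pj; exact: leq_trans ck.
  rewrite ltnS /p' /f' => ck.
  by case: ltnP => [ck'|_] //; exact: npf.
exists (v (p' 0%N)), (\matrix_(x < k.+1, c < k.+1) (v (p' c.+1) - v (p' 0%N)) x 0).
split=> [//||c|x _]; first exact: (dual_pair_vert va).
  rewrite (_ : _ + _ = v (p' c.+1)); first exact: (dual_pair_vert va).
  by apply/colP => x; rewrite !mxE addrC subrK.
move/eqP: rX; rewrite -/(row_free _) row_free_unit => Xu.
by exists (invmx (\matrix_(x < k.+1, c < k.+1) (v (p' c.+1) - v (p' 0%N)) x 0) *m
  (x - v (p' 0%N))); rewrite mulKVmx // addrC subrK.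
Qed.

Lemma facet_at_dim j : has_dim (facet_at j) k.
Proof.
have [p [f [pj pf npf]]] := facet_flag comb j.
have := flag_rank pf npf; set X := \matrix_(x, c) _ => rX.
have Fp c : (c <= k)%N -> facet_at j (v (p c)) by move=> /pj /facet_at_vert.
exists (v (p 0%N)), X; split=> [//||c|x [_ /= xj]]; first exact: Fp.
  rewrite (_ : _ + _ = v (p c.+1)); first exact: Fp.
  by apply/colP => x; rewrite !mxE addrC subrK.
have [_ /= p0j] := Fp 0%N isT.
have a0 : a j != 0.
  by apply/eqP => aj0; move/eqP: xj; rewrite aj0 /dot trmx0 mul0mx mxE eq_sym oner_eq0.
have ra : \rank (a j) = 1%N.
  by apply/eqP; rewrite eqn_leq rank_leq_col lt0n mxrank_eq0.
have Xker : (X^T <= kermx (a j))%MS.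
  apply/sub_kermxP; apply/trmx_inj; rewrite trmx_mul trmxK trmx0.
  apply/rowP => c; rewrite [RHS]mxE.
  have [_ /= pcj] := Fp c.+1 (ltn_ord c).
  transitivity (dot (a j) (v (p c.+1) - v (p 0%N))); last by rewrite dotBr pcj p0j subrr.
  by rewrite dotE mxE; apply: eq_bigr => y _; rewrite !mxE.
have kerX : (kermx (a j) <= X^T)%MS.
  by rewrite -(mxrank_leqif_sup Xker).2 mxrank_tr rX mxrank_ker ra subSS subn0.
have /submxP[c cE] : ((x - v (p 0%N))^T <= X^T)%MS.
  apply: submx_trans kerX; apply/sub_kermxP; apply/trmx_inj.
  rewrite trmx_mul trmxK trmx0; apply/matrixP => y z; rewrite !ord1 [RHS]mxE.
  by rewrite -/(dot _ _) dotBr xj p0j subrr.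
exists c^T; apply/trmx_inj; rewrite linearD /= trmx_mul trmxK -cE -linearD /=.
by rewrite addrC subrK.
Qed.

Lemma facet_facet_at j : facet Q (facet_at j).
Proof.
split; first exact: facet_at_face.
by exists k => //; exact: facet_at_dim.
Qed.

(** A face of codimension one lies on some [facet_at j], as otherwise it would be
    the whole polytope; having the same dimension, the two have the same affine
    hull and hence coincide. *)
Lemma facetE (j0 : 'I_m) F : facet Q F -> exists j, F = facet_at j.
Proof.
move=> [fF [k' [k'k]]]; rewrite {}k'k => dF.
have FQ : F `<=` Q by case: fF => [? [? [_ ->]]] x [].
have [[j Fj]|noj] := pselect (exists j, forall i, F (v i) -> inc i j); last first.
  have QF : Q `<=` F.
    move=> x Qx; rewrite (face_closed va (vertex_avoids comb) fF); split=> // j jF.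
    by case: noj; exists j.
  by have := has_dim_le QF (half_spaces_dim j0) dF; rewrite ltnn.
have F_Fj : F `<=` facet_at j.
  by apply: (face_sub va fF (facet_at_face j)) => i /Fj /facet_at_vert.
exists j; apply/seteqP; split=> // x xj.
case: (fF) => c [b [cb FE]]; rewrite FE; split; first by case: xj.
apply: (has_dim_hyperplane F_Fj dF (facet_at_dim j)) xj.
by move=> y; rewrite FE => -[].
Qed.

Lemma vert_set_bij : set_bij [set: 'I_n] [set w | vertex Q w] v.
Proof.
split=> [i _|i i' _ _ /vert_inj //|w /vertexE[i ->]]; first exact: vertex_face.
by exists i.
Qed.

Lemma facet_set_bij (j0 : 'I_m) :
  set_bij [set: 'I_m] [set F | facet Q F] facet_at.
Proof.
split=> [j _|j j' _ _ /facet_at_inj //|F /(facetE j0)[j ->]].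
  exact: facet_facet_at.
by exists j.
Qed.

Lemma half_spaces_polytope (j0 : 'I_m) : is_polytope Q.
Proof.
split; last exact: half_spaces_dim j0.
exists (range v); last by rewrite /Q -va.2.
exact: finite_image.
Qed.

Definition dual_pair_polytope (j0 : 'I_m) : labeled_polytope R k.+1 n m :=
  LabeledPolytope (half_spaces_polytope j0) vert_set_bij (facet_set_bij j0).

End VerticesFacets.

(** A face is sent to the intersection of the facets that correspond to the
    facets through it; both faces have the same vertex labels. *)
Lemma dual_pair_realizes (R : realType) k n m (inc : 'I_n -> 'I_m -> bool)
    (P P' : labeled_polytope R k.+1 n m) v a v' a' :
  polytopal k inc -> dual_pair inc v a -> dual_pair inc v' a' ->
  body P = half_spaces a -> (forall i, vert P i = v i) ->
  (forall j, fct P j = facet_at a j) ->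
  body P' = half_spaces a' -> (forall i, vert P' i = v' i) ->
  (forall j, fct P' j = facet_at a' j) -> realizes P' P.
Proof.
move=> comb va va' bP vP fP bP' vP' fP'.
have apex := vertex_avoids comb.
pose lift_face (b : 'I_m -> 'cV[R]_k.+1) (w : 'I_n -> 'cV[R]_k.+1)
  (F : set 'cV[R]_k.+1) := closed_face inc b (fun i => F (w i)).
have lift_vert (w : 'I_n -> 'cV[R]_k.+1) b (w' : 'I_n -> 'cV[R]_k.+1) b' F i :
    dual_pair inc w b -> dual_pair inc w' b' ->
    face (half_spaces b) F -> lift_face b' w F (w' i) <-> F (w i).
  move=> wb wb' fF; rewrite /lift_face (closed_face_vert wb').
  by rewrite {2}(face_closed wb apex fF) (closed_face_vert wb).
exists (lift_face a' v); rewrite bP bP'; split.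
- split=> [F _|F G|G] /=; first exact: closed_face_face.
    rewrite !inE => fF fG FG; apply: (face_eq va) => // i.
    by rewrite -(lift_vert _ _ _ _ _ _ va va' fF) FG (lift_vert _ _ _ _ _ _ va va' fG).
  move=> fG; have fF := closed_face_face inc a (fun i => G (v' i)).
  exists (lift_face a v' G) => //; apply: (face_eq va') => // [|i].
    exact: closed_face_face.
  by rewrite (lift_vert _ _ _ _ (lift_face a v' G) _ va va' fF) (lift_vert _ _ _ _ _ _ va' va fG).
- move=> F G fF fG; split=> FG.
    apply: (face_sub va'); [exact: closed_face_face|exact: closed_face_face|].
    move=> i; rewrite (lift_vert _ _ _ _ _ _ va va' fF).
    by rewrite (lift_vert _ _ _ _ _ _ va va' fG) => /FG.
  apply: (face_sub va) => // i.
  rewrite -(lift_vert _ _ _ _ _ _ va va' fF) => /FG.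
  by rewrite (lift_vert _ _ _ _ _ _ va va' fG).
- move=> i; rewrite vP vP' -(closed_face_set1 comb va') /lift_face.
  congr (closed_face inc a' _); apply/funext => i' /=; apply/propext.
  by split=> [/(vert_inj comb va)|->].
- move=> j; rewrite fP fP' -[facet_at a' j](closed_face_facet comb) /lift_face.
    congr (closed_face inc a' _); apply/funext => i /=; apply/propext.
  exact: (facet_at_vert va).
Qed.

(** * The 24-cell and its deformation in integers *)

Section CellData.

Local Open Scope nat_scope.

Definition dotZ (x y : seq Z) : Z :=
  (nth 0 x 0 * nth 0 y 0 + nth 0 x 1 * nth 0 y 1 +
   nth 0 x 2 * nth 0 y 2 + nth 0 x 3 * nth 0 y 3)%BZ.

Definition axisZ (c : Z) (k : nat) : seq Z :=
  [seq if l == k then c else 0%BZ | l <- iota 0 4].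

Definition addZ (x y : seq Z) : seq Z :=
  [seq (nth 0 x l + nth 0 y l)%BZ | l <- iota 0 4].

Definition scaleZ (c : Z) (x : seq Z) : seq Z := [seq (c * y)%BZ | y <- x].

Definition sgnZ (s : bool) : Z := if s then (-1)%BZ else 1%BZ.

Definition bools : seq bool := [:: false; true].

Definition rootZ (a b : nat) (s t : bool) : seq Z :=
  addZ (axisZ (sgnZ s) a) (axisZ (sgnZ t) b).

Definition roots : seq (seq Z) :=
  [seq rootZ ab.1 ab.2 st.1 st.2 |
    ab <- [:: (0, 1); (0, 2); (0, 3); (1, 2); (1, 3); (2, 3)],
    st <- [seq (s, t) | s <- bools, t <- bools]].

(** Twice the facet normals of the regular cell, so that incidence means that the
    inner product with a root is 2. *)
Definition coroots : seq (seq Z) :=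
  [seq axisZ (2 * sgnZ s) k | k <- iota 0 4, s <- bools] ++
  [seq [:: sgnZ st.1; sgnZ st.2; sgnZ uv.1; sgnZ uv.2] |
    st <- [seq (s, t) | s <- bools, t <- bools],
    uv <- [seq (s, t) | s <- bools, t <- bools]].

Definition signed_axis (c : Z) (e : Z) : seq Z :=
  axisZ (c * Z.sgn e) (Z.abs_nat e).-1.

(** With [t = 1/N] and all vertices multiplied by [N], the orbit of [(1, 1, t, 0)]
    is [N * root + direction]. *)
Definition root_dirs : seq (seq Z) :=
  [seq signed_axis 1 e | e <-
  [:: 3; 4; -4; -3; -4; -2; 2; 4; -3; 2; -2; 3;
      4; -1; 1; -4; 1; -3; 3; -1; -1; -2; 2; 1]%BZ].

(** Multiplying the normals by [2 * N - 1] turns [(p, q, p, p)] into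
    [(N, N - 2, N, N)] and [e_i] into [(2 * N - 1) * e_i]; both have the form
    [N * coroot - direction]. *)
Definition coroot_dirs : seq (seq Z) :=
  [seq signed_axis 1 e | e <- [:: 1; -1; 2; -2; 3; -3; 4; -4]%BZ] ++
  [seq signed_axis 2 e | e <-
  [:: 2; 1; 4; -4; -2; 3; 1; -3; 3; -1; -3; 2; 4; -4; -1; -2]%BZ].

Definition root (i : nat) := nth [::] roots i.
Definition coroot (j : nat) := nth [::] coroots j.

Definition incZ (i j : nat) : bool := (dotZ (root i) (coroot j) =? 2)%BZ.

Definition deformed_vertex (N : Z) (i : nat) : seq Z :=
  addZ (scaleZ N (root i)) (nth [::] root_dirs i).

Definition deformed_normal (N : Z) (j : nat) : seq Z :=
  addZ (scaleZ N (coroot j)) (scaleZ (-1) (nth [::] coroot_dirs j)).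

Definition incidences : seq (nat * nat) :=
  Eval vm_compute in
  [seq ij <- [seq (i, j) | i <- iota 0 24, j <- iota 0 24] | incZ ij.1 ij.2].

Lemma deformed_incident : all (fun i => all (fun j =>
  incZ i j ==> (dotZ (deformed_vertex 1000 i) (deformed_normal 1000 j) =? 1000 * 1999)%BZ)
  (iota 0 24)) (iota 0 24).
Proof. by vm_compute. Qed.

Definition jac_row (N : Z) (ij : nat * nat) : seq Z :=
  flatten ([seq if i == ij.1 then deformed_normal N ij.2 else nseq 4 0%BZ | i <- iota 0 24] ++
           [seq if j == ij.2 then deformed_vertex N ij.1 else nseq 4 0%BZ | j <- iota 0 24]).

(** Gauss-Jordan elimination modulo 7 of the Jacobian augmented by an identity
    matrix.  It only serves to find a right inverse, which [jac_mul_mod7] then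
    verifies independently; the inverse of a pivot [x] is [x ^ 5]. *)
Fixpoint pop_pivot (c : nat) (rows : seq (seq Z)) : option (seq Z * seq (seq Z)) :=
  if rows is r :: rows' then
    if (nth 0 r c =? 0)%BZ then
      if pop_pivot c rows' is Some (p, rest) then Some (p, r :: rest) else None
    else Some (r, rows')
  else None.

Fixpoint sub_row (c : Z) (r p : seq Z) : seq Z :=
  match r, p with
  | x :: r', y :: p' => ((x - c * y) mod 7)%BZ :: sub_row c r' p'
  | _, _ => [::]
  end.

Definition clear (c : nat) (p r : seq Z) : seq Z :=
  let x := nth 0%BZ r c in if (x =? 0)%BZ then r else sub_row x r p.

Fixpoint gauss_jordan (fuel c : nat) (rows : seq (seq Z))
    (done : seq (nat * seq Z)) : seq (nat * seq Z) :=
  if fuel is fuel'.+1 then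
    if pop_pivot c rows is Some (r, rest) then
      let p := [seq (nth 0 r c ^ 5 * x mod 7)%BZ | x <- r] in
      gauss_jordan fuel' c.+1 [seq clear c p r' | r' <- rest]
        ((c, p) :: [seq (cr.1, clear c p cr.2) | cr <- done])
    else gauss_jordan fuel' c.+1 rows done
  else done.

Definition augmented : seq (seq Z) :=
  [seq [seq (x mod 7)%BZ | x <- jac_row 1000 (nth (0, 0) incidences e)] ++
       [seq if e' == e then 1%BZ else 0%BZ | e' <- iota 0 144] | e <- iota 0 144].

Definition right_inverse_rows : seq (nat * seq Z) :=
  [seq (cr.1, drop 192 cr.2) | cr <- gauss_jordan 192 0 augmented [::]].

(** Non-pivot columns of the Jacobian get a zero row, the default of [nth].  The
    result is indexed by incidence, then by vertex or facet, then by coordinate. *)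
Definition right_inverse : seq (seq (seq Z)) :=
  Eval vm_compute in
  let rows := right_inverse_rows in
  let table := [seq nth [::] (unzip2 rows) (index c (unzip1 rows)) | c <- iota 0 192] in
  [seq reshape (nseq 48 4) [seq nth 0%BZ r e | r <- table] | e <- iota 0 144].

Definition jac_mul (e e' : nat) : Z :=
  let ij := nth (0, 0) incidences e in
  let K := nth [::] right_inverse e' in
  (dotZ (deformed_normal 1000 ij.2) (nth [::] K ij.1) +
   dotZ (deformed_vertex 1000 ij.1) (nth [::] K (24 + ij.2)))%BZ.

Lemma jac_mul_mod7 : all (fun e' => all (fun e =>
  (jac_mul e e' mod 7 =? (if e == e' then 1 else 0))%BZ) (iota 0 144)) (iota 0 144).
Proof. by vm_compute. Qed.

End CellData.

(** * Combinatorics of the 24-cell and independence of the differentials *)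

Lemma all_iotaP n (P : pred nat) (i : 'I_n) : all P (iota 0 n) -> P i.
Proof. by move=> /allP; apply; rewrite mem_iota /=. Qed.

Lemma all2_iotaP n m (P : nat -> nat -> bool) (i : 'I_n) (j : 'I_m) :
  all (fun i => all (P i) (iota 0 m)) (iota 0 n) -> P i j.
Proof. by move=> /(all_iotaP i)/(all_iotaP j). Qed.

Section ZtoR.
Context (R : realType).

Definition zR (z : Z) : R := (int_of_Z z)%:~R.

Lemma zRD x y : zR (x + y)%BZ = zR x + zR y.
Proof. by rewrite /zR -intrD -(rmorphD int_of_Z). Qed.

Lemma zRM x y : zR (x * y)%BZ = zR x * zR y.
Proof. by rewrite /zR -intrM -(rmorphM int_of_Z). Qed.

Lemma zR_le x y : (x <=? y)%BZ -> zR x <= zR y.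
Proof. by move=> /Z.leb_le xy; rewrite /zR ler_int; lia. Qed.

Lemma zR_nat n : zR (Z.of_nat n) = n%:R.
Proof. by rewrite /zR -[Z.of_nat n]/(Z_of_int (Posz n)) Z_of_intK. Qed.

Lemma zR_sgn s : zR (sgnZ s) = (-1) ^+ s.
Proof. by case: s. Qed.

Definition vecR (x : seq Z) : 'cV[R]_4 := \col_(k < 4) zR (nth 0%BZ x k).

Lemma dot_vecR x y : dot (vecR x) (vecR y) = zR (dotZ x y).
Proof.
by rewrite dotE !big_ord_recr big_ord0 /= !mxE /= add0r /dotZ !zRD !zRM.
Qed.

Lemma vecR_add x y : vecR (addZ x y) = vecR x + vecR y.
Proof.
apply/colP => k; rewrite !mxE /addZ (nth_map 0%N) ?size_iota //.
by rewrite nth_iota // add0n zRD.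
Qed.

Lemma vecR_scale c x : vecR (scaleZ c x) = zR c *: vecR x.
Proof.
apply/colP => k; rewrite !mxE /scaleZ -zRM; congr zR.
have [kx|xk] := ltnP k (size x); first by rewrite (nth_map 0%BZ).
by rewrite !nth_default ?size_map // Z.mul_0_r.
Qed.

Lemma vecR_axis c (k : 'I_4) : vecR (axisZ c k) = zR c *: delta_mx k 0.
Proof.
apply/colP => l; rewrite !mxE /axisZ (nth_map 0%N) ?size_iota //.
rewrite nth_iota // add0n eqxx andbT -val_eqE; case: eqP => _; first by rewrite mulr1.
by rewrite mulr0.
Qed.

End ZtoR.
Arguments zR {R}.
Arguments vecR {R}.

Definition inc24 (i j : 'I_24) : bool := incZ i j.

Lemma size_incidences : size incidences = 144%N.
Proof. by vm_compute. Qed.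

Lemma uniq_incidences : uniq incidences.
Proof. by vm_compute. Qed.

Lemma mem_incidences (i j : 'I_24) :
  inc24 i j -> (i : nat, j : nat) \in incidences.
Proof.
move=> ij; have : all (fun i => all (fun j => incZ i j ==> ((i, j) \in incidences))
  (iota 0 24)) (iota 0 24) by vm_compute.
by move=> /(all2_iotaP i j)/implyP; apply.
Qed.

Lemma incidencesP (e : 'I_144) : let ij := nth (0, 0)%N incidences e in
  [/\ (ij.1 < 24)%N, (ij.2 < 24)%N & incZ ij.1 ij.2].
Proof.
have : all (fun ij => [&& (ij.1 < 24)%N, (ij.2 < 24)%N & incZ ij.1 ij.2]) incidences.
  by vm_compute.
move=> /allP /(_ (nth (0, 0)%N incidences e)) h.
by apply/and3P; apply: h; rewrite mem_nth // size_incidences.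
Qed.

Definition exists24 (P : pred nat) : bool := has P (iota 0 24).

Lemma exists24P P : exists24 P -> exists i : 'I_24, P i.
Proof.
move=> /hasP[i]; rewrite mem_iota => /andP[_ i24] Pi.
by exists (Ordinal i24).
Qed.

Definition incidence_table : seq (seq bool) :=
  Eval vm_compute in [seq [seq incZ i j | j <- iota 0 24] | i <- iota 0 24].

Definition in_table i j : bool := nth false (nth [::] incidence_table i) j.

Lemma in_tableE (i j : 'I_24) : inc24 i j = in_table i j.
Proof.
have : all (fun i => all (fun j => incZ i j == in_table i j) (iota 0 24)) (iota 0 24).
  by vm_compute.
by move=> /(all2_iotaP i j)/eqP.
Qed.

(** Checked by lazy conversion, since the nested searches are only feasible when
    conjunctions are evaluated from the left and stop early. *)
Lemma flags_exist : all (fun j =>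
  exists24 (fun p0 => in_table p0 j &&
  exists24 (fun f0 => in_table p0 f0 &&
  exists24 (fun p1 => [&& in_table p1 j, ~~ in_table p1 f0 &
  exists24 (fun f1 => [&& in_table p0 f1, in_table p1 f1 &
  exists24 (fun p2 => [&& in_table p2 j, ~~ in_table p2 f1 &
  exists24 (fun f2 => [&& in_table p0 f2, in_table p1 f2, in_table p2 f2 &
  exists24 (fun p3 => in_table p3 j && ~~ in_table p3 f2)])])])]))))
  (iota 0 24).
Proof. exact: erefl. Qed.

Lemma inc24_polytopal : polytopal 3 inc24.
Proof.
have vac : all (fun i => all (fun i' => all (fun j => in_table i j ==> in_table i' j) (iota 0 24)
   ==> (i == i')) (iota 0 24)) (iota 0 24) by vm_compute.
have fac : all (fun j => all (fun j' => all (fun i => in_table i j ==> in_table i j') (iota 0 24)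
   ==> (j == j')) (iota 0 24)) (iota 0 24) by vm_compute.
have vav : all (fun i => exists24 (fun j => ~~ in_table i j)) (iota 0 24) by vm_compute.
have fav : all (fun j => exists24 (fun i => ~~ in_table i j)) (iota 0 24) by vm_compute.
split.
- move=> i i' ii'; apply/val_inj/eqP; have := all2_iotaP i i' vac.
  move=> /implyP; apply; apply/allP => j; rewrite mem_iota => /andP[_ j24].
  have := ii' (Ordinal j24); rewrite !in_tableE /= => h.
  by apply/implyP.
- move=> j j' jj'; apply/val_inj/eqP; have := all2_iotaP j j' fac.
  move=> /implyP; apply; apply/allP => i; rewrite mem_iota => /andP[_ i24].
  have := jj' (Ordinal i24); rewrite !in_tableE /= => h.
  by apply/implyP.
- by move=> i; have /exists24P[j ij] := all_iotaP i vav; exists j; rewrite in_tableE.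
- by move=> j; have /exists24P[i ij] := all_iotaP j fav; exists i; rewrite in_tableE.
move=> j; have /exists24P[p0 /andP[p0j /exists24P[f0 /andP[p0f0 /exists24P[p1 /and3P[p1j p1f0
  /exists24P[f1 /and3P[p0f1 p1f1 /exists24P[p2 /and3P[p2j p2f1 /exists24P[f2 /and4P[p0f2 p1f2 p2f2
  /exists24P[p3 /andP[p3j p3f2]]]]]]]]]]]]]] := all_iotaP j flags_exist.
exists (nth p3 [:: p0; p1; p2]), (nth f2 [:: f0; f1]).
split=> [c|c b|c]; rewrite ?ltnS in_tableE.
- by case: c => [|[|[|[|c]]]].
- by case: c b => [|[|[|c]]] [|[|[|b]]].
- by case: c => [|[|[|c]]].
Qed.

Section Jacobian.
Context (R : realType).

Definition deformed_vertex_vec (i : 'I_24) : 'cV[R]_4 :=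
  1000%:R^-1 *: vecR (deformed_vertex 1000 i).
Definition deformed_normal_vec (j : 'I_24) : 'cV[R]_4 :=
  1999%:R^-1 *: vecR (deformed_normal 1000 j).

(** An integer matrix congruent to the identity modulo 7 has a determinant that is
    not divisible by 7. *)
Lemma jac_mul_unit :
  \matrix_(e < 144, e' < 144) (zR (jac_mul e e') : R) \in unitmx.
Proof.
pose C : 'M[int]_144 := \matrix_(e, e') int_of_Z (jac_mul e e').
have -> : \matrix_(e < 144, e' < 144) (zR (jac_mul e e') : R) = map_mx intr C.
  by apply/matrixP => e e'; rewrite !mxE.
rewrite unitmxE unitfE det_map_mx intr_eq0.
suff : (\det C)%:~R != 0 :> 'F_7 by apply: contraNneq => ->.
rewrite -det_map_mx (_ : map_mx _ C = 1%:M) ?det1 ?oner_eq0 //.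
apply/matrixP => e e'; rewrite !mxE.
have /Z.eqb_eq h := all2_iotaP e' e jac_mul_mod7.
have -> : int_of_Z (jac_mul e e') =
    7%:Z * int_of_Z (jac_mul e e' / 7)%BZ + Posz (e == e').
  rewrite {1}(Z.div_mod (jac_mul e e') 7) // h -val_eqE /=.
  rewrite (rmorphD int_of_Z); congr (_ + _).
    by rewrite -[7%:Z]/(int_of_Z 7%BZ) -(rmorphM int_of_Z).
  by case: (e == e' :> nat).
rewrite /= intrD intrM (_ : 7%:~R = 0 :> 'F_7); last exact/eqP.
by rewrite mul0r add0r; case: (e == e').
Qed.

Lemma jacobian_surjective (b : 'I_24 -> 'I_24 -> R) :
  exists dv da : 'I_24 -> 'cV[R]_4, forall i j, inc24 i j ->
    dot (deformed_normal_vec j) (dv i) + dot (da j) (deformed_vertex_vec i) = b i j.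
Proof.
pose pair (e : nat) := nth (0, 0)%N incidences e.
pose be : 'cV[R]_144 := \col_e b (inord (pair e).1) (inord (pair e).2).
set C := \matrix_(e < 144, e' < 144) (zR (jac_mul e e') : R).
pose y := invmx C *m be.
have Cy : C *m y = be by rewrite mulKVmx // jac_mul_unit.
pose K (e' : 'I_144) := nth [::] right_inverse e'.
exists (fun i => 1999%:R *: \sum_e' y e' 0 *: vecR (nth [::] (K e') i)),
       (fun j => 1000%:R *: \sum_e' y e' 0 *: vecR (nth [::] (K e') (24 + j)%N)).
move=> i j ij.
rewrite /deformed_normal_vec /deformed_vertex_vec !(dotZl, dotZr) !mulrA
   !(mulfV, mulVf) ?pnatr_eq0 // !mul1r.
rewrite [X in _ + X]dotC !dot_sumr -big_split /=.
have ijI := mem_incidences ij.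
have e144 : (index (i : nat, j : nat) incidences < 144)%N.
  by rewrite -size_incidences index_mem.
have pe : pair (Ordinal e144) = (i : nat, j : nat) by rewrite /pair nth_index.
have := congr1 (fun M : 'cV[R]_144 => M (Ordinal e144) 0) Cy.
rewrite [RHS]mxE pe /= !inord_val => <-.
rewrite mxE; apply: eq_bigr => e' _.
rewrite !dotZr !dot_vecR [C _ _]mxE -mulrDr mulrC -zRD /jac_mul.
by rewrite -/(pair (Ordinal e144)) pe.
Qed.

End Jacobian.

(** * Polyhedra close to the regular 24-cell *)

Section Tables.
Context (R : realType).

Definition root_vec (i : 'I_24) : 'cV[R]_4 := vecR (root i).
Definition coroot_vec (j : 'I_24) : 'cV[R]_4 := 2^-1 *: vecR (coroot j).

Lemma cell24_hull : cell24 R = convex_hull (range root_vec).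
Proof.
rewrite /cell24; congr convex_hull; apply/seteqP; split.
  move=> _ [i [j [s [t [ij ->]]]]].
  have : rootZ i j s t \in roots.
    apply: (allpairs_f (fun ab st => rootZ ab.1 ab.2 st.1 st.2)
      (x := (i : nat, j : nat)) (y := (s, t))).
      by move: i j ij => [[|[|[|[|]]]] // ?] [[|[|[|[|]]]] // ?].
    by move: s t => [] [].
  move=> /(nthP [::])[l l24 lE]; exists (Ordinal (l24 : (l < 24)%N)) => //.
  by rewrite /root_vec /root /= lE vecR_add !vecR_axis !zR_sgn.
move=> _ [l _ <-]; have : root l \in roots by exact: mem_nth.
move=> /allpairsP[[[a b] [s t]] /= [ab _ rE]].
have /and3P[a4 b4 ltab] : [&& (a < 4)%N, (b < 4)%N & (a < b)%N].
  by move: ab; rewrite !inE => /or4P[|||/or3P[]] /eqP[-> ->].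
exists (Ordinal a4), (Ordinal b4), s, t; split=> //.
by rewrite /root_vec rE vecR_add -!zR_sgn -!vecR_axis.
Qed.

Lemma half_spaces_coroot (x : 'cV[R]_4) z : half_spaces coroot_vec x ->
  z \in coroots -> dot (vecR z) x <= 2.
Proof.
move=> hx /(nthP [::])[l l24 <-].
have := hx (Ordinal (l24 : (l < 24)%N)); rewrite dotZl /coroot /=; lra.
Qed.

Lemma half_spaces_coroot_coord (x : 'cV[R]_4) k : half_spaces coroot_vec x ->
  `|x k 0| <= 1.
Proof.
move=> hx; have h (s : bool) : (-1) ^+ s * x k 0 <= 1.
  have : axisZ (2 * sgnZ s)%BZ k \in coroots.
    by move: k s => [[|[|[|[|]]]] // ?] [].
  move=> /(half_spaces_coroot hx); rewrite vecR_axis dotZl dot_delta zRM zR_sgn.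
  rewrite (_ : zR 2%BZ = 2) //; lra.
have := h false; have := h true; rewrite expr0 expr1 ler_norml; lra.
Qed.

Lemma half_spaces_coroot_l1 (x : 'cV[R]_4) : half_spaces coroot_vec x ->
  \sum_k `|x k 0| <= 2.
Proof.
move=> hx.
pose s (k : 'I_4) : bool := x k 0 < 0.
pose z := [:: sgnZ (s (inord 0)); sgnZ (s (inord 1)); sgnZ (s (inord 2)); sgnZ (s (inord 3))].
have zc : z \in coroots.
  by rewrite /z; move: (s _) (s _) (s _) (s _) => [] [] [] [].
apply: le_trans (half_spaces_coroot hx zc).
rewrite dotE le_eqVlt; apply/orP; left; apply/eqP/eq_bigr => k _.
rewrite normrEsign mxE -/(s k) -zR_sgn; congr (zR _ * _).
rewrite -{1}(inord_val k) /z.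
by case: k => [[|[|[|[|]]]] // ?].
Qed.

Lemma dot_coroot_root i j : dot (coroot_vec j) (root_vec i) =
  2^-1 * zR (dotZ (coroot j) (root i)).
Proof. by rewrite dotZl dot_vecR. Qed.

Lemma dotZC x y : dotZ x y = dotZ y x.
Proof. by rewrite /dotZ !(Z.mul_comm (nth _ x _)). Qed.

Lemma coroot_root_inc i j : inc24 i j -> dot (coroot_vec j) (root_vec i) = 1.
Proof.
rewrite dot_coroot_root dotZC => /Z.eqb_eq ->.
by rewrite (_ : zR 2%BZ = 2) // mulVf.
Qed.

Lemma coroot_root_ninc i j : ~~ inc24 i j -> dot (coroot_vec j) (root_vec i) <= 0.
Proof.
have : all (fun i => all (fun j => ~~ incZ i j ==>
  (dotZ (root i) (coroot j) <=? 0)%BZ) (iota 0 24)) (iota 0 24) by vm_compute.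
move=> /(all2_iotaP i j)/implyP h /h /zR_le h0.
rewrite dot_coroot_root dotZC pmulr_rle0 //; exact: h0.
Qed.

Lemma root_entry i k : `|root_vec i k 0| <= 1.
Proof.
have : all (fun i => all (fun k => (nth 0 (root i) k <=? 1) &&
  (-1 <=? nth 0 (root i) k))%BZ (iota 0 4)) (iota 0 24) by vm_compute.
move=> /(all2_iotaP i k)/andP[/(zR_le R) h1 /(zR_le R) h2].
by rewrite mxE ler_norml; apply/andP; split; [exact: h2 | exact: h1].
Qed.

(** The maximum [M] of [c] over the roots is at least the sum of any two of the
    absolute values of the coordinates of [c].  If all of these are at most [M / 2],
    then [c x <= M / 2 * |x|_1 <= M].  If one exceeds [M / 2], the others are at most
    [M] minus it, and the bound on that coordinate of [x] finishes. *)
Lemma root_support (c : 'cV[R]_4) : exists i, forall x,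
  half_spaces coroot_vec x -> dot c x <= dot c (root_vec i).
Proof.
pose i := [arg max_(i > ord0) dot c (root_vec i)]%O.
exists i; set M := dot c (root_vec i).
have Mmax l : dot c (root_vec l) <= M by rewrite /M /i; case: arg_maxP => // i' _; exact.
have pair_lt (a b : 'I_4) : (a < b)%N -> `|c a 0| + `|c b 0| <= M.
  move=> ab; set s := c a 0 < 0; set t := c b 0 < 0.
  have : cell24 R ((-1) ^+ s *: delta_mx a 0 + (-1) ^+ t *: delta_mx b 0).
    by apply: sub_gen_smallest; exists a, b, s, t.
  rewrite cell24_hull => /(@convex_hull_half _ _ _ c M) h.
  have {}h := h _; rewrite !normrEsign -/s -/t.
  rewrite -!dot_delta !(dotC _ c) -!dotZr -dotDr; apply: h.
  by move=> _ [l _ <-] /=; exact: Mmax.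
have pair_ne a b : a != b -> `|c a 0| + `|c b 0| <= M.
  rewrite neq_ltn => /orP[/pair_lt //|/pair_lt]; by rewrite addrC.
move=> x hx.
have x1 k := half_spaces_coroot_coord k hx.
have xl1 := half_spaces_coroot_l1 hx.
have M0 : 0 <= M by apply: le_trans (pair_lt ord0 (inord 1) _); rewrite ?inordK // addr_ge0.
apply: (@le_trans _ _ (\sum_k `|c k 0| * `|x k 0|)).
  by rewrite dotE; apply: ler_sum => k _; rewrite -normrM ler_norm.
have [[k kM]|/forallNP small] := pselect (exists k, M / 2 < `|c k 0|).
  rewrite (bigD1 k) //=.
  have rest : \sum_(l | l != k) `|c l 0| * `|x l 0| <= (M - `|c k 0|) * (2 - `|x k 0|).
    apply: (@le_trans _ _ (\sum_(l | l != k) (M - `|c k 0|) * `|x l 0|)).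
      apply: ler_sum => l lk; rewrite ler_wpM2r //.
      by have := pair_ne _ _ lk; lra.
    rewrite -mulr_sumr ler_wpM2l //.
      by have := pair_ne k (lift k ord0) (neq_lift _ _); have := normr_ge0 (c (lift k ord0) 0); lra.
    by move: xl1; rewrite (bigD1 k) //=; lra.
  have := x1 k; have := normr_ge0 (x k 0); nra.
apply: (@le_trans _ _ (\sum_k M / 2 * `|x k 0|)).
  by apply: ler_sum => k _; rewrite ler_wpM2r // leNgt; apply/negP/small.
rewrite -mulr_sumr; nra.
Qed.

(** The constant 400: inner products with points of norm at most 2 move by at most
    [4 * 2 / 400 = 1/50], and [near_tight_cover] needs the gap 1 to exceed the total
    error of at most [(2 * 24 - 1) / 50]. *)
Section Near.
Context (v a : 'I_24 -> 'cV[R]_4).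
Hypothesis nearv : forall i, `|v i - root_vec i| <= 400^-1.
Hypothesis neara : forall j, `|a j - coroot_vec j| <= 400^-1.
Hypothesis tight : forall i j, inc24 i j -> dot (a j) (v i) = 1.

Let a_close j x : `|dot (a j) x - dot (coroot_vec j) x| <= 100^-1 * `|x|.
Proof.
rewrite !(dotC _ x) -dotBr; apply: le_trans (dot_norm_le _ _) _.
rewrite mulrAC ler_wpM2r //.
have := neara j; lra.
Qed.

(** The vectors +e_k and -e_k are among the normals of the regular cell. *)
Let coord_le t (x : 'cV[R]_4) : 0 < t -> (forall j, dot (coroot_vec j) x <= t) ->
  `|x| <= t.
Proof.
move=> t0 hx; apply: mx_norm_le => [|k l]; first exact: ltW.
rewrite ord1; have hy : half_spaces coroot_vec (t^-1 *: x).
  by move=> j; rewrite dotZr ler_pdivrMl // mulr1.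
have := half_spaces_coroot_coord k hy.
by rewrite mxE normrM normfV (gtr0_norm t0) ler_pdivrMl // mulr1.
Qed.

Lemma near_no_recession u : (forall j, dot (a j) u <= 0) -> u = 0.
Proof.
move=> au; apply/eqP; rewrite -normr_le0 leNgt; apply/negP => u0.
have : `|u| <= 100^-1 * `|u|.
  apply: coord_le => [|j]; first by rewrite mulr_gt0.
  have := a_close j u; have := au j; rewrite ler_norml; lra.
lra.
Qed.

(** Let [c] be the sum of the normals, in the regular cell, of the constraints in
    the set [J] tight at [x].  Then [c x] is almost [|J|], whereas [x] almost lies in
    the regular cell, where [c] is bounded by its value at some root; that value
    would be at most [|J| - 1] if the root missed a constraint of [J]. *)
Lemma near_tight_cover x : half_spaces a x ->
  exists i, forall j, dot (a j) x = 1 -> inc24 i j.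
Proof.
move=> ax.
have x2 : `|x| <= 2.
  have : `|x| <= 1 + 100^-1 * `|x|.
    apply: coord_le => [|j]; first by rewrite ltr_pwDl // mulr_ge0.
    have := a_close j x; have := ax j; rewrite ler_norml; lra.
  lra.
have a0x j : `|dot (a j) x - dot (coroot_vec j) x| <= 50^-1.
  by have := a_close j x; lra.
pose J j := dot (a j) x == 1.
pose c := \sum_(j | J j) coroot_vec j.
have [i imax] := root_support c.
exists i => j0 /eqP j0x; apply: contraT => nij0.
pose s : R := \sum_(j | J j) 1.
have s24 : s <= 24.
  rewrite /s sumr_const -[24%:R]/(24%:R) ler_nat.
  by rewrite -[leqRHS]card_ord max_card.
have lower : (1 - 50^-1) * s <= dot c x.
  rewrite /s mulr_sumr dot_suml; apply: ler_sum => j /eqP jx.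
  by have := a0x j; rewrite jx ler_norml; lra.
have upper : dot c x <= (1 + 50^-1) * dot c (root_vec i).
  have : dot c ((1 + 50^-1)^-1 *: x) <= dot c (root_vec i).
    apply: imax => j; rewrite dotZr ler_pdivrMl ?mulr1; last by lra.
    by have := a0x j; have := ax j; rewrite ler_norml; lra.
  by rewrite dotZr ler_pdivrMl //; lra.
have cv : dot c (root_vec i) <= s - 1.
  rewrite dot_suml /s (bigD1 j0) //= [X in _ <= X - 1](bigD1 j0) //=.
  rewrite addrAC subrr add0r -[leRHS]add0r lerD //; first exact: coroot_root_ninc.
  apply: ler_sum => j _; have [/coroot_root_inc -> //|/coroot_root_ninc] := boolP (inc24 i j).
  by move/le_trans; apply.
lra.
Qed.

Lemma near_dot_lt1 i j : ~~ inc24 i j -> dot (a j) (v i) < 1.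
Proof.
move=> /coroot_root_ninc ij.
have v0 : `|root_vec i| <= 1 by apply: mx_norm_le => // k l; rewrite ord1; exact: root_entry.
have v2 : `|v i| <= 2.
  rewrite -[v i](subrK (root_vec i)); apply: le_trans (ler_normD _ _) _.
  by have := nearv i; lra.
have a1 : `|coroot_vec j| <= 1.
  apply: mx_norm_le => // k l; rewrite ord1.
  have : all (fun j => all (fun k => (nth 0 (coroot j) k <=? 2) &&
    (-2 <=? nth 0 (coroot j) k))%BZ (iota 0 4)) (iota 0 24) by vm_compute.
  move=> /(all2_iotaP j k)/andP[/(zR_le R) h1 /(zR_le R) h2].
  have {}h1 : zR (nth 0%BZ (coroot j) k) <= 2 :> R by exact: h1.
  have {}h2 : - 2 <= zR (nth 0%BZ (coroot j) k) :> R by exact: h2.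
  by rewrite !mxE ler_norml; lra.
have := a_close j (v i); have := dot_norm_le (coroot_vec j) (v i - root_vec i).
rewrite dotBr => h1 h2.
have : `|coroot_vec j| * `|v i - root_vec i| <= 1 * 400^-1 by rewrite ler_pM.
move: h1 h2; rewrite -mulrA !ler_norml; lra.
Qed.

Lemma near_dual_pair : dual_pair inc24 v a.
Proof.
have av i : half_spaces a (v i).
  move=> j; have [/tight -> //|/near_dot_lt1 /ltW //] := boolP (inc24 i j).
split=> [i j|].
  have [/tight ->|/near_dot_lt1 /lt_eqF //] := boolP (inc24 i j).
  by rewrite eqxx.
apply/seteqP; split=> [x vx j|].
  apply: (@convex_hull_half _ _ _ (a j) 1) vx => _ [i _ <-] /=; exact: av.
apply: half_spaces_sub_hull => // [u|x /near_tight_cover[i ix]].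
  exact: near_no_recession.
by exists i => j /ix /tight.
Qed.

End Near.

Lemma cell24_dual_pair : dual_pair inc24 root_vec coroot_vec.
Proof.
apply: near_dual_pair; last exact: coroot_root_inc.
  by move=> i; rewrite subrr normr0 invr_ge0 ler0n.
by move=> j; rewrite subrr normr0 invr_ge0 ler0n.
Qed.

Lemma deformed_vertex_near (i : 'I_24) : `|deformed_vertex_vec R i - root_vec i| <= 999^-1.
Proof.
have dirs : all (fun i => all (fun k => (nth 0 (nth [::] root_dirs i) k <=? 1) &&
  (-1 <=? nth 0 (nth [::] root_dirs i) k))%BZ (iota 0 4)) (iota 0 24) by vm_compute.
apply: mx_norm_le => [|k l]; first by rewrite invr_ge0 ler0n.
rewrite ord1.
have /andP[/(zR_le R) h1 /(zR_le R) h2] := all2_iotaP i k dirs.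
have {}h1 : zR (nth 0%BZ (nth [::] root_dirs i) k) <= 1 :> R by exact: h1.
have {}h2 : - 1 <= zR (nth 0%BZ (nth [::] root_dirs i) k) :> R by exact: h2.
rewrite /deformed_vertex_vec /deformed_vertex vecR_add vecR_scale !mxE (zR_nat R 1000).
rewrite ler_norml; lra.
Qed.

Lemma deformed_normal_near (j : 'I_24) : `|deformed_normal_vec R j - coroot_vec j| <= 999^-1.
Proof.
have dirs : all (fun j => all (fun k =>
  (nth 0 (coroot j) k + -2 * nth 0 (nth [::] coroot_dirs j) k <=? 3) &&
  (-3 <=? nth 0 (coroot j) k + -2 * nth 0 (nth [::] coroot_dirs j) k))%BZ
  (iota 0 4)) (iota 0 24) by vm_compute.
apply: mx_norm_le => [|k l]; first by rewrite invr_ge0 ler0n.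
rewrite ord1.
have /andP[/(zR_le R) h1 /(zR_le R) h2] := all2_iotaP j k dirs.
rewrite zRD zRM in h1 h2.
have {}h1 : zR (nth 0%BZ (coroot j) k) +
    (- 2) * zR (nth 0%BZ (nth [::] coroot_dirs j) k) <= 3 :> R by exact: h1.
have {}h2 : - 3 <= zR (nth 0%BZ (coroot j) k) +
    (- 2) * zR (nth 0%BZ (nth [::] coroot_dirs j) k) :> R by exact: h2.
rewrite /deformed_normal_vec /deformed_normal vecR_add !vecR_scale !mxE (zR_nat R 1000).
rewrite (_ : zR (-1)%BZ = - 1) // ler_norml; lra.
Qed.

Lemma deformed_vertex_tight (i j : 'I_24) : inc24 i j ->
  dot (deformed_normal_vec R j) (deformed_vertex_vec R i) = 1.
Proof.
have /implyP h := all2_iotaP i j deformed_incident.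
move=> /h /Z.eqb_eq ij.
rewrite dotZl dotZr dot_vecR dotZC ij zRM.
rewrite (zR_nat R 1000) (zR_nat R 1999) mulKf ?pnatr_eq0 // mulVf ?pnatr_eq0 //.
Qed.

End Tables.

(** * Incidence equations and labels *)

Section Relabel.
Context (n m : nat) (s s' : 'I_n -> 'I_n) (t t' : 'I_m -> 'I_m).
Hypotheses (sK : cancel s s') (s'K : cancel s' s).
Hypotheses (tK : cancel t t') (t'K : cancel t' t).

Definition relabel (inc : 'I_n -> 'I_m -> bool) i j := inc (s i) (t j).

Lemma polytopal_relabel k inc : polytopal k inc -> polytopal k (relabel inc).
Proof.
move=> [va fa av af ff]; split.
- move=> i i' h; apply/(can_inj sK)/va => j.
  by have := h (t' j); rewrite /relabel ?s'K ?t'K.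
- move=> j j' h; apply/(can_inj tK)/fa => i.
  by have := h (s' i); rewrite /relabel ?s'K ?t'K.
- by move=> i; have [j ij] := av (s i); exists (t' j); rewrite /relabel ?s'K ?t'K.
- by move=> j; have [i ij] := af (t j); exists (s' i); rewrite /relabel ?s'K ?t'K.
move=> j; have [p [f [pj pf npf]]] := ff (t j).
exists (fun c => s' (p c)), (fun c => t' (f c)).
split=> [c /pj|c b ck bc|c ck]; rewrite /relabel !(s'K, t'K) //; first exact: pf.
exact: npf.
Qed.

Lemma dual_pair_relabel (R : realType) d inc v a : @dual_pair R d n m inc v a ->
  dual_pair (relabel inc) (v \o s) (a \o t).
Proof.
move=> [va hull]; split=> [i j|]; first exact: va.
have -> : range (v \o s) = range v.
  apply/seteqP; split=> _ [i _ <-]; first by exists (s i).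
  by exists (s' i) => //=; rewrite ?s'K ?t'K.
rewrite hull; apply/seteqP; split=> x ax j /=; first exact: ax.
by have := ax (t' j); rewrite /= ?s'K ?t'K.
Qed.

End Relabel.

Section Equations.
Context (R : realType) (s t : 'I_24 -> 'I_24).

Let vcol (M : 'M[R]_(4, 24 + 24)) i := col i (lsubmx M).
Let acol (M : 'M[R]_(4, 24 + 24)) j := col j (rsubmx M).

Definition vert_of (e : 'I_144) : 'I_24 := s (inord (nth (0, 0)%N incidences e).1).
Definition fct_of (e : 'I_144) : 'I_24 := t (inord (nth (0, 0)%N incidences e).2).

Definition incidence_eqns (M : 'M[R]_(4, 24 + 24)) : 'rV[R]_144 :=
  \row_e (dot (acol M (fct_of e)) (vcol M (vert_of e)) - 1).

Definition incidence_diff (M h : 'M[R]_(4, 24 + 24)) : 'rV[R]_144 :=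
  \row_e (dot (acol M (fct_of e)) (vcol h (vert_of e)) +
          dot (acol h (fct_of e)) (vcol M (vert_of e))).

Definition incidence_quad (e : 'I_144) : 'M[R]_(4 * (24 + 24)) :=
  \sum_k delta_mx (mxvec_index k (rshift 24 (fct_of e)))
                  (mxvec_index k (lshift 24 (vert_of e))).

Definition incidence_diff_mx (M : 'M[R]_(4, 24 + 24)) : 'M[R]_(4 * (24 + 24), 144) :=
  lin1_mx (incidence_diff M \o vec_mx).

Lemma incidence_diff_linear M : linear (incidence_diff M \o vec_mx).
Proof.
move=> c u w; apply/rowP => e.
have vD i : vcol (vec_mx (c *: u + w)) i =
    c *: vcol (vec_mx u) i + vcol (vec_mx w) i by rewrite /vcol !linearP.
have aD j : acol (vec_mx (c *: u + w)) j =
    c *: acol (vec_mx u) j + acol (vec_mx w) j by rewrite /acol !linearP.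
rewrite [LHS]mxE vD aD [RHS]mxE [X in _ = X + _]mxE.
rewrite ![(incidence_diff M \o vec_mx) _ _ _]mxE.
rewrite dotDr dotDl dotZr dotZl; ring.
Qed.

Lemma incidence_diff_mxE M h : mxvec h *m incidence_diff_mx M = incidence_diff M h.
Proof.
pose L := GRing.isLinear.Build _ _ _ _ _ (incidence_diff_linear M).
pose L' : {linear 'rV[R]_(4 * (24 + 24)) -> 'rV[R]_144} :=
  HB.pack (incidence_diff M \o vec_mx) L.
rewrite -[RHS]/(incidence_diff M h) -[in RHS](mxvecK h).
exact: (mul_rV_lin1 L' (mxvec h)).
Qed.

Lemma mul_delta_form N (u w : 'rV[R]_N) a b :
  (u *m delta_mx a b *m w^T) 0 0 = u 0 a * w 0 b.
Proof.
rewrite mxE (bigD1 b) //= big1 ?addr0 => [|c cb].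
  rewrite mxE (bigD1 a) //= big1 ?addr0 => [|c /negPf ca].
    by rewrite !mxE !eqxx mulr1.
  by rewrite mxE ca mulr0.
rewrite mxE big1 ?mul0r // => c' _; rewrite mxE (negPf cb) andbF mulr0 //.
Qed.

Lemma incidence_eqns_expand M h : incidence_eqns (M + h) =
  incidence_eqns M + (mxvec h *m incidence_diff_mx M +
  \row_e (mxvec h *m incidence_quad e *m (mxvec h)^T) 0 0).
Proof.
rewrite incidence_diff_mxE; apply/rowP => e.
rewrite [LHS]mxE [RHS]mxE [X in _ = X + _]mxE [X in _ = _ + X]mxE.
rewrite [X in _ = _ + (X + _)]mxE [X in _ = _ + (_ + X)]mxE.
have -> : (mxvec h *m incidence_quad e *m (mxvec h)^T) 0 0 =
    dot (acol h (fct_of e)) (vcol h (vert_of e)).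
  rewrite /incidence_quad mulmx_sumr mulmx_suml summxE dotE.
  by apply: eq_bigr => k _; rewrite mul_delta_form !mxvecE !mxE.
rewrite [RHS]addrAC; congr (_ - 1); rewrite !dotE -!big_split /=.
by apply: eq_bigr => k _; rewrite !mxE; ring.
Qed.

End Equations.

Section Labelled.
Context (R : realType) (P : labeled_polytope R 4 24 24) (hP : body P = cell24 R).
Context (s s' t t' : 'I_24 -> 'I_24).
Hypotheses (sK : cancel s s') (s'K : cancel s' s).
Hypotheses (tK : cancel t t') (t'K : cancel t' t).
Hypothesis vP : forall i, vert P i = root_vec R (s i).
Hypothesis fP : forall j, fct P j = facet_at (coroot_vec R) (t j).

Let inc := relabel s t inc24.
Let vcol (M : 'M[R]_(4, 24 + 24)) i := col i (lsubmx M).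
Let acol (M : 'M[R]_(4, 24 + 24)) j := col j (rsubmx M).

Definition place (v a : 'I_24 -> 'cV[R]_4) : 'M[R]_(4, 24 + 24) :=
  row_mx (\matrix_(k, i) v (s i) k 0) (\matrix_(k, j) a (t j) k 0).

Lemma vcol_place v a i : vcol (place v a) i = v (s i).
Proof. by apply/colP => k; rewrite /vcol row_mxKl !mxE. Qed.

Lemma acol_place v a j : acol (place v a) j = a (t j).
Proof. by apply/colP => k; rewrite /acol row_mxKr !mxE. Qed.

Lemma body_half_spaces : body P = half_spaces (coroot_vec R).
Proof. by rewrite hP cell24_hull (cell24_dual_pair R).2. Qed.

Let inc_polytopal : polytopal 3 inc.
Proof. exact: polytopal_relabel inc24_polytopal. Qed.

Lemma realization_incidence M i j : centered_realization_space P M -> inc i j ->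
  dot (acol M j) (vcol M i) = 1.
Proof.
move=> [_ [Q [bQ vQ fQ [f [_ f_le fv ff]]]]] ij.
have fv0 : face (body P) [set vert P i].
  by have [h _ _] := vert_bij P; exact: (h i I).
have ff0 : face (body P) (fct P j).
  by have [h _ _] := fct_bij P; have [] := h j I.
have : [set vert P i] `<=` fct P j.
  rewrite vP fP => _ ->.
  exact/(facet_at_vert (cell24_dual_pair R)).
move=> /(f_le _ _ fv0 ff0); rewrite fv ff vQ fQ => /(_ _ erefl)[_ /=]; exact.
Qed.

Lemma incidence_realization M :
  `|M - place (root_vec R) (coroot_vec R)| < 400^-1 ->
  (forall i j, inc i j -> dot (acol M j) (vcol M i) = 1) ->
  centered_realization_space P M.
Proof.
move=> Mnear Mtight.
have va : dual_pair inc24 (vcol M \o s') (acol M \o t').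
  apply: near_dual_pair => [i|j|i j ij] /=.
  - apply: mx_norm_le => [|k l]; first by rewrite invr_ge0 ler0n.
    apply: le_trans (ltW Mnear); rewrite ord1.
    apply: le_trans (mx_entry_le _ k (lshift 24 (s' i))).
    have -> : root_vec R i = vcol (place (root_vec R) (coroot_vec R)) (s' i).
      by rewrite vcol_place s'K.
    by rewrite !mxE.
  - apply: mx_norm_le => [|k l]; first by rewrite invr_ge0 ler0n.
    apply: le_trans (ltW Mnear); rewrite ord1.
    apply: le_trans (mx_entry_le _ k (rshift 24 (t' j))).
    have -> : coroot_vec R j = acol (place (root_vec R) (coroot_vec R)) (t' j).
      by rewrite acol_place t'K.
    by rewrite !mxE.
  - by apply: Mtight; rewrite /inc /relabel s'K t'K.
have {}va : dual_pair inc (vcol M) (acol M).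
  have := dual_pair_relabel s'K t'K va.
  rewrite (_ : (vcol M \o s') \o s = vcol M); last first.
    by apply/funext => i /=; rewrite sK.
  rewrite (_ : (acol M \o t') \o t = acol M) //.
  by apply/funext => j /=; rewrite tK.
have va0 : dual_pair inc (root_vec R \o s) (coroot_vec R \o t).
  exact: dual_pair_relabel (cell24_dual_pair R).
have hullE : convex_hull (columns (lsubmx M)) = half_spaces (acol M) by exact: va.2.
split=> /=.
  have polyE x j : ((rsubmx M)^T *m x) j ord0 = dot (acol M j) x.
    by rewrite dotE mxE; apply: eq_bigr => k _; rewrite !mxE.
  rewrite hullE; apply/seteqP; split=> x xA j; first by rewrite polyE.
  by rewrite -polyE.
exists (dual_pair_polytope inc_polytopal va ord0); split=> [//|//|//|].
apply: (dual_pair_realizes inc_polytopal va0 va) => //.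
- rewrite body_half_spaces; apply/seteqP; split=> x xa j; first exact: xa.
  by have := xa (t' j); rewrite /= t'K.
- move=> j; rewrite fP /facet_at; congr (_ `&` _).
  apply/seteqP; split=> x xa k /=; first exact: xa.
  by have := xa (t' k); rewrite /= t'K.
Qed.

Let inc_of e : inc (vert_of s' e) (fct_of t' e).
Proof.
have [i24 j24 ij] := incidencesP e.
by rewrite /inc /relabel /vert_of /fct_of s'K t'K /inc24 !inordK.
Qed.

Let of_inc i j : inc i j -> exists e, i = vert_of s' e /\ j = fct_of t' e.
Proof.
move=> /mem_incidences/(nthP (0, 0)%N)[e]; rewrite size_incidences => e144 eE.
exists (Ordinal e144); rewrite /vert_of /fct_of /= eE !inord_val.
by rewrite sK tK.
Qed.

Lemma incidence_eqnsP M : incidence_eqns s' t' M = 0 <->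
  forall i j, inc i j -> dot (acol M j) (vcol M i) = 1.
Proof.
split=> [M0 i j /of_inc[e [-> ->]]|M1].
  by have /rowP/(_ e)/eqP := M0; rewrite !mxE subr_eq0 => /eqP.
by apply/rowP => e; rewrite !mxE -/(vcol _ _) -/(acol _ _) M1 ?subrr.
Qed.

Lemma incidence_diff_surj : exists S : 'M[R]_(144, 4 * (24 + 24)),
  S *m incidence_diff_mx s' t' (place (deformed_vertex_vec R) (deformed_normal_vec R)) = 1%:M.
Proof.
set M0 := place _ _.
have /choice[h hE] (e : 'I_144) : exists h, incidence_diff s' t' M0 h = delta_mx 0 e.
  pose b (i j : 'I_24) : R :=
    (delta_mx 0 e : 'rV[R]_144) 0 (inord (index (i : nat, j : nat) incidences)).
  have [dv [da dE]] := jacobian_surjective b.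
  exists (place dv da); apply/rowP => e'.
  rewrite mxE -!/(vcol _ _) -!/(acol _ _) !vcol_place !acol_place.
  have [i24 j24 ij] := incidencesP e'.
  rewrite dE; last exact: inc_of.
  rewrite /b /vert_of /fct_of s'K t'K !inordK // -surjective_pairing.
  by rewrite index_uniq ?size_incidences ?uniq_incidences // inord_val.
exists (\matrix_e mxvec (h e)); apply/row_matrixP => e.
by rewrite row_mul rowK incidence_diff_mxE hE row1.
Qed.

(** [Mr] is the regular cell and [M0] the deformed one, at distance less than
    1/400 from each other; the open set is a neighbourhood of [M0]. *)
Lemma labelled_manifold : exists O : set 'M[R]_(4, 24 + 24),
  [/\ open O, centered_realization_space P `&` O !=set0 &
      embedded_submanifold 48 (centered_realization_space P `&` O)].
Proof.
pose Mr := place (root_vec R) (coroot_vec R).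
pose M0 := place (deformed_vertex_vec R) (deformed_normal_vec R).
have M0_eqns : incidence_eqns s' t' M0 = 0.
  apply/incidence_eqnsP => i j ij.
  by rewrite vcol_place acol_place deformed_vertex_tight.
have [S SD] := incidence_diff_surj.
have FE h : incidence_eqns s' t' (M0 + h) =
    mxvec h *m incidence_diff_mx s' t' M0 +
    \row_e (mxvec h *m incidence_quad R s' t' e *m (mxvec h)^T) 0 0.
  by rewrite incidence_eqns_expand M0_eqns add0r.
have kr : (48 + 144 = 4 * (24 + 24))%N by [].
have [N1 [N1_open N1M0 N1sub]] := quadratic_level_set kr FE SD.
pose N2 := [set M : 'M[R]_(4, 24 + 24) | `|M - Mr| < 400^-1].
have N2_open : open N2.
  rewrite (_ : N2 = ball Mr 400^-1); first exact: ball_open.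
  by apply/seteqP; split=> M; rewrite -ball_normE /N2 /= distrC.
have N2M0 : N2 M0.
  apply: (@le_lt_trans _ _ 999^-1); last by rewrite ltf_pV2 ?qualifE /= ?ltr0n // ltr_nat.
  apply: mx_norm_le => [|k l]; first by rewrite invr_ge0 ler0n.
  rewrite -(fintype.splitK l); case: (fintype.split l) => i /=.
    apply: le_trans (deformed_vertex_near R (s i)); apply: le_trans (mx_entry_le _ k 0).
    rewrite -(vcol_place (deformed_vertex_vec R) (deformed_normal_vec R)).
    by rewrite -(vcol_place (root_vec R) (coroot_vec R)) !mxE.
  apply: le_trans (deformed_normal_near R (t i)); apply: le_trans (mx_entry_le _ k 0).
  rewrite -(acol_place (deformed_vertex_vec R) (deformed_normal_vec R)).
  by rewrite -(acol_place (root_vec R) (coroot_vec R)) !mxE.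
have space_eqns M : N2 M ->
    centered_realization_space P M <-> incidence_eqns s' t' M = 0.
  move=> N2M; split=> [PM|/incidence_eqnsP]; last exact: incidence_realization.
  by apply/incidence_eqnsP => i j; exact: realization_incidence.
exists (N1 `&` N2).
have -> : centered_realization_space P `&` (N1 `&` N2) =
    [set M | incidence_eqns s' t' M = 0] `&` (N1 `&` N2).
  apply/seteqP; split=> M [PM [N1M N2M]]; split=> //.
    by apply/space_eqns.
  by apply/space_eqns.
split; first exact: openI.
  by exists M0.
by apply: N1sub; [exact: openI | exact: subIsetl].
Qed.

End Labelled.

Theorem corollary5p9 (R : realType) (P : labeled_polytope R 4 24 24)
    (hP : body P = cell24 R) :
  exists O : set 'M[R]_(4, 24 + 24),
    [/\ open O,
        centered_realization_space P `&` O !=set0 &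
        embedded_submanifold 48 (centered_realization_space P `&` O)].
Proof.
have va := cell24_dual_pair R.
have bP : body P = half_spaces (coroot_vec R) by rewrite hP cell24_hull va.2.
have [vP vinj _] := vert_bij P; have [fP finj _] := fct_bij P.
have /choice[s sE] i : exists k, vert P i = root_vec R k.
  by apply: (vertexE va); rewrite -bP; exact: vP.
have /choice[t tE] j : exists k, fct P j = facet_at (coroot_vec R) k.
  by apply: (facetE inc24_polytopal va ord0); rewrite -bP; exact: fP.
have /injF_bij[s' sK s'K] : injective s.
  by move=> i i' ii'; apply: vinj; rewrite ?inE // !sE ii'.
have /injF_bij[t' tK t'K] : injective t.
  by move=> j j' jj'; apply: finj; rewrite ?inE // !tE jj'.
exact: labelled_manifold hP _ _ _ _ sK s'K tK t'K sE tE.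
Qed.
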